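(* Let $(\alpha_0,\beta_0)\in U$, let $\underline M=K(\alpha_0,\beta_0)$ (so $\beta_0=\Psi_{\underline M}(\alpha_0)$), let $\mu$ be the unique absolutely continuous invariant probability measure of $T_{\alpha_0,\beta_0}$, and let $\Lambda_{\alpha_0,\beta_0}$ be the Lyapunov exponent of $T_{\alpha_0,\beta_0}$. Then $\Psi_{\underline M}'(\alpha_0)$ exists and $$\Lambda_{\alpha_0,\beta_0}=\gamma\log\frac{\beta_0}{\alpha_0}+(1-\gamma)\log\frac{\beta_0}{1-\alpha_0},$$ where $$\gamma=\frac{\frac{\Psi'_{\underline M}(\alpha_0)}{\beta_0}+\frac{1}{1-\alpha_0}}{\frac{1}{\alpha_0}+\frac{1}{1-\alpha_0}}=\alpha_0(1-\alpha_0)\frac{\Psi'_{\underline M}(\alpha_0)}{\beta_0}+\alpha_0,$$ and moreover $\gamma=\mu([0,\alpha_0])$.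
   Context: For $0<\alpha<1$ and $0\le\beta\le1$ the skew tent map $T_{\alpha,\beta}:[0,1]\to[0,1]$ is $T_{\alpha,\beta}(x)=\frac{\beta}{\alpha}x$ for $0\le x\le\alpha$ and $T_{\alpha,\beta}(x)=\frac{\beta}{1-\alpha}(1-x)$ for $\alpha<x\le1$. Let $U=\{(\alpha,\beta): \tfrac12<\beta\le1,\ 1-\beta<\alpha<\beta\}$. For $(\alpha,\beta)\in U$ the extended kneading sequence $(\mathfrak m_1,\mathfrak m_2,\dots)\in\{L,C,R\}^{\mathbb N}$ is defined by $\mathfrak m_n=L$, $C$ or $R$ according as $T^n_{\alpha,\beta}(\alpha)<\alpha$, $=\alpha$ or $>\alpha$. The kneading sequence $K(\alpha,\beta)$ is the extended kneading sequence if it contains no $C$, and otherwise is the finite string obtained by stopping at the first $C$. Let $\mathfrak M=\{K(\alpha,\beta):(\alpha,\beta)\in U\}$. It is known that for each $\underline M\in\mathfrak M$ there exist $\alpha_1(\underline M)<\alpha_2(\underline M)$ and a continuous function $\Psi_{\underline M}$ on $(\alpha_1(\underline M),\alpha_2(\underline M))$ with $(\alpha,\Psi_{\underline M}(\alpha))\in U$ such that for $(\alpha,\beta)\in U$: $K(\alpha,\beta)=\underline M$ iff $\alpha\in(\alpha_1(\underline M),\alpha_2(\underline M))$ and $\beta=\Psi_{\underline M}(\alpha)$ (the isentrope). For $(\alpha,\beta)\in U$, $T_{\alpha,\beta}$ has a unique absolutely continuous (w.r.t. Lebesgue measure $\lambda$) invariant probability measure (acim), which is ergodic. The Lyapunov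 exponent is $\Lambda_{\alpha,\beta}=\lim_{N\to\infty}\frac1N\log|(T^N_{\alpha,\beta})'(x)|$, which exists and is the same for $\mu$-a.e. $x$ ($\mu$ the acim). *)

(* Defs.v *)
From Stdlib Require Import Reals Lra.
Open Scope R_scope.

(* The skew tent map T_{a,b}, written on all of R with the same two formulas
   (only its restriction to [0,1] matters). *)
Definition T (a b x : R) : R :=
  if Rle_dec x a then b / a * x else b / (1 - a) * (1 - x).

Definition iterT (a b : R) (n : nat) : R -> R := Nat.iter n (T a b).

Definition inU (a b : R) : Prop := 1/2 < b <= 1 /\ 1 - b < a < b.

Inductive sym : Type := SL | SC | SR.

Definition ext_knead (a b : R) (n : nat) : sym :=
  match total_order_T (iterT a b n a) a with
  | inleft (left _) => SL
  | inleft (right _) => SC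
  | inright _ => SR
  end.

Definition isC (s : sym) : bool := match s with SC => true | _ => false end.

Fixpoint stopped (a b : R) (k : nat) : bool :=
  match k with
  | O => false
  | S j => orb (stopped a b j) (isC (ext_knead a b (S j)))
  end.

(* Kneading sequence K(a,b), encoded as a partial sequence indexed from 1:
   K a b n = Some m_n while no C has occurred strictly before position n,
   and None afterwards (so a finite kneading string ends with its first C).
   Index 0 is unused (always None). *)
Definition K (a b : R) (n : nat) : option sym :=
  match n with
  | O => None
  | S k => if stopped a b k then None else Some (ext_knead a b (S k))
  end.

Definition knead_eq (a b a' b' : R) : Prop := forall n, K a b n = K a' b' n.

Definition abs_cont_01 (F : R -> R) : Prop :=
  forall eps, eps > 0 -> exists delta, delta > 0 /\
    forall (n : nat) (l r : nat -> R),
      (forall i, (i < n)%nat -> 0 <= l i <= r i /\ r i <= 1) ->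
      (forall i, (S i < n)%nat -> r i <= l (S i)) ->
      (n = O \/ sum_f_R0 (fun i => r i - l i) (pred n) < delta) ->
      (n = O \/ sum_f_R0 (fun i => Rabs (F (r i) - F (l i))) (pred n) < eps).

(* An absolutely continuous (w.r.t. Lebesgue) probability measure mu on [0,1]
   is represented by its distribution function F(t) = mu([0,t]), t in [0,1]:
   F nondecreasing, F(0) = 0, F(1) = 1, F absolutely continuous on [0,1];
   then mu([c,d]) = F d - F c. *)
Definition is_ac_cdf (F : R -> R) : Prop :=
  F 0 = 0 /\ F 1 = 1 /\
  (forall s t, 0 <= s <= t -> t <= 1 -> F s <= F t) /\
  abs_cont_01 F.

(* T_{a,b}-invariance mu(T^{-1}[0,t]) = mu([0,t]) for all t in [0,1]
   (intervals [0,t] generate the Borel sets and form a pi-system).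
   For (a,b) in U, T^{-1}[0,t] = [0, min(a, a t/b)] U [max(a, 1-(1-a)t/b), 1]
   up to the single point a, which is mu-null. *)
Definition is_invariant_cdf (a b : R) (F : R -> R) : Prop :=
  forall t, 0 <= t <= 1 ->
    F (Rmin a (a * t / b)) + (1 - F (Rmax a (1 - (1 - a) * t / b))) = F t.

Definition is_acim_cdf (a b : R) (F : R -> R) : Prop :=
  is_ac_cdf F /\ is_invariant_cdf a b F.

Definition mu_null (F : R -> R) (A : R -> Prop) : Prop :=
  forall eps, eps > 0 -> exists l r : nat -> R,
    (forall n, 0 <= l n <= r n /\ r n <= 1) /\
    (forall x, 0 <= x <= 1 -> A x -> exists n, l n <= x <= r n) /\
    (forall N, sum_f_R0 (fun n => F (r n) - F (l n)) N < eps).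

Definition is_lyapunov (a b : R) (F : R -> R) (Lam : R) : Prop :=
  mu_null F (fun x =>
    ~ exists d : nat -> R,
        (forall N, derivable_pt_lim (iterT a b N) x (d N)) /\
        Un_cv (fun N => ln (Rabs (d (S N))) / INR (S N)) Lam).

(* Main.v *)
(* Write T = T_{a,b}, X_j = T^j(b) for the orbit of the peak, W_j for the product of the inverse
   slopes of T along X_0, ..., X_{j-1}, and Z = Σ W_j X_j.

   Derivative of the isentrope.  If (a',b') has the same itinerary as (a,b), with peak orbit Y_j,
   then b Y_j - b' X_j telescopes along the common inverse branches, which gives the exact relation
   (b' - b) Σ W_j Y_j = (a' - a) Σ W_j Y_{j+1}; hence Ψ'(a) = (Σ W_j X_{j+1}) / Z.

   The invariant measure.  H(t) = Σ W_j min(X_j, t) is the distribution function of an unnormalised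
   invariant measure of total mass Z, and the two formulas give
   a (1 - a) Ψ'(a) / b + a = H(a) / Z.  It remains to see that F(a) = H(a) / Z for the given acim,
   without knowing its density.  The numbers Leb([0,y] ∩ T^{-n}[0,t]) satisfy a recursion in n whose
   Cesàro means converge to y H(t) / Z; this also excludes Z = 0, because H has a kink at b.  So the
   frequencies of visits to [0,a] converge weakly-* in L^∞(Leb) to H(a) / Z.  Their integral against
   the acim is constantly F(a), and the acim has an L^1 density, whence F(a) = H(a) / Z.  The
   formula for the Lyapunov exponent follows by dominated convergence. *)

Require Import Defs.
From Stdlib Require Import Reals Lra Lia Arith.
From Coquelicot Require Import Coquelicot.
Open Scope R_scope.

(** Most of the argument rests on one equation, u(y) = e(y) + u(T y) / slope(y). Since the inverse
    slopes are bounded by a constant below 1, its bounded solution along an orbit is unique, namely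
    Σ W_j e_j. The identity function solves it with e the indicator of the right branch. The Cesàro
    means of the sojourns solve it with m times that indicator, where m is their value at b divided
    by b, plus an error of order 1/N. So they equal m y up to O(1/N), and summing this relation with
    the weights W_j along the peak orbit forces m Z to approach H(t). Averaging in n matters: when
    the slopes are close to 1 the map can permute disjoint intervals cyclically, and Leb([0,y] ∩
    T^{-n}[0,t]) can then oscillate. The W_j change sign at each visit to the right branch, so H is
    a priori only the distribution function of a signed measure and Z could vanish; this is why Z ≠
    0 needs an argument of its own, placed before any division by Z. *)

Definition slope (a b x : R) : R := if Rle_dec x a then b / a else - (b / (1 - a)).

(** The constant term of the inverse branch through [x]: on the right, x = 1 - (1 - a) / b · T x. As
    in [slope] and [T], the turning point counts as left. *)
Definition right_ind (a x : R) : R := if Rle_dec x a then 0 else 1.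

Fixpoint weight (a b : R) (n : nat) (x : R) : R :=
  match n with
  | O => 1
  | S k => weight a b k x / slope a b (iterT a b k x)
  end.

(* The Lebesgue measure of [0,y] ∩ T^{-n}[0,t]. *)
Fixpoint sojourn (a b t : R) (n : nat) (y : R) : R :=
  match n with
  | O => Rmin y t
  | S k => sojourn a b t k (T a b y) / slope a b y
           + right_ind a y * (sojourn a b t k b / b)
  end.

(** * Expansions along the orbit of the peak *)

Section Orbits.

Variables a b : R.
Hypothesis HU : inU a b.

Lemma inU_bounds : 0 < a /\ a < 1 /\ 0 < b /\ b <= 1 /\ a < b /\ 1 - a < b.
Proof. destruct HU as [[? ?] [? ?]]; lra. Qed.

Lemma T_range x : 0 <= x <= 1 -> 0 <= T a b x <= b.
Proof.
  destruct inU_bounds as (ha & ha1 & hb & _).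
  intros hx; unfold T; destruct (Rle_dec x a) as [h|h].
  - assert (0 <= x / a <= 1).
    { split; [apply Rdiv_le_0_compat; lra | apply Rle_div_l; lra]. }
    replace (b / a * x) with (b * (x / a)) by (field; lra); nra.
  - assert (0 <= (1 - x) / (1 - a) <= 1).
    { split; [apply Rdiv_le_0_compat; lra | apply Rle_div_l; lra]. }
    replace (b / (1 - a) * (1 - x)) with (b * ((1 - x) / (1 - a))) by (field; lra); nra.
Qed.

Lemma iterT_range n x : 0 <= x <= 1 -> 0 <= iterT a b n x <= 1.
Proof.
  destruct inU_bounds as (_ & _ & _ & hb & _).
  intros hx; induction n as [|n IH]; [exact hx|].
  simpl; pose proof (T_range _ IH); lra.
Qed.

Lemma iterT_le_peak n x : 0 <= x <= b -> 0 <= iterT a b n x <= b.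
Proof.
  destruct inU_bounds as (_ & _ & _ & hb & _).
  intros hx; destruct n as [|n]; [exact hx|].
  apply T_range, iterT_range; lra.
Qed.

Lemma iterT_add m n x : iterT a b (m + n) x = iterT a b m (iterT a b n x).
Proof. induction m as [|m IH]; [reflexivity | simpl; now rewrite IH]. Qed.

Lemma iterT_succ_r n x : iterT a b (S n) x = iterT a b n (T a b x).
Proof. replace (S n) with (n + 1)%nat by lia; apply (iterT_add n 1). Qed.

Lemma T_turning : T a b a = b.
Proof.
  destruct inU_bounds as (ha & _).
  unfold T; destruct (Rle_dec a a) as [_|h]; [field; lra | lra].
Qed.

Lemma slope_neq0 x : slope a b x <> 0.
Proof.
  destruct inU_bounds as (ha & ha1 & hb & _).
  unfold slope; destruct (Rle_dec x a).
  - apply Rgt_not_eq, Rdiv_lt_0_compat; lra.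
  - apply Ropp_neq_0_compat, Rgt_not_eq, Rdiv_lt_0_compat; lra.
Qed.

Lemma inverse_branch x : x = right_ind a x + T a b x / slope a b x.
Proof.
  destruct inU_bounds as (ha & ha1 & hb & _).
  unfold T, slope, right_ind; destruct (Rle_dec x a); field; lra.
Qed.

(** The larger of the two inverse slopes in absolute value. The conditions a < b and 1 - a < b of U
    are what puts it below 1. *)
Definition contraction : R := Rmax (a / b) ((1 - a) / b).

Lemma contraction_bounds : 0 < contraction < 1.
Proof.
  destruct inU_bounds as (ha & ha1 & hb & hb1 & hab & hab1).
  unfold contraction; split.
  - apply Rlt_le_trans with (a / b); [apply Rdiv_lt_0_compat; lra | apply Rmax_l].
  - apply Rmax_lub_lt; apply Rlt_div_l; lra.
Qed.

Lemma slope_inv_le x : Rabs (/ slope a b x) <= contraction.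
Proof.
  destruct inU_bounds as (ha & ha1 & hb & _).
  unfold slope, contraction; destruct (Rle_dec x a).
  - replace (/ (b / a)) with (a / b) by (field; lra).
    rewrite Rabs_pos_eq; [apply Rmax_l | apply Rdiv_le_0_compat; lra].
  - replace (/ - (b / (1 - a))) with (- ((1 - a) / b)) by (field; lra).
    rewrite Rabs_Ropp, Rabs_pos_eq; [apply Rmax_r | apply Rdiv_le_0_compat; lra].
Qed.

Lemma weight_le n x : Rabs (weight a b n x) <= contraction ^ n.
Proof.
  induction n as [|n IH]; simpl; [rewrite Rabs_R1; lra|].
  unfold Rdiv; rewrite Rabs_mult, Rmult_comm.
  apply Rmult_le_compat; auto using Rabs_pos, slope_inv_le.
Qed.

Lemma weight_add m n x :
  weight a b (m + n) x = weight a b n x * weight a b m (iterT a b n x).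
Proof.
  induction m as [|m IH]; simpl; [ring|].
  rewrite IH, iterT_add; field; apply slope_neq0.
Qed.

(** * Weighted sums along an orbit *)

Definition wsum (y : R) (u : nat -> R) : R := Series (fun j => weight a b j y * u j).

Lemma geom_scal_ex c : ex_series (fun j => c * contraction ^ j).
Proof.
  apply (ex_series_scal_l c (fun j => contraction ^ j)), ex_series_geom.
  pose proof contraction_bounds; rewrite Rabs_pos_eq; lra.
Qed.

Lemma wsum_term_le y u B n : (forall j, Rabs (u j) <= B) ->
  Rabs (weight a b n y * u n) <= B * contraction ^ n.
Proof.
  intros hu; rewrite Rabs_mult, Rmult_comm.
  apply Rmult_le_compat; auto using Rabs_pos, weight_le.
Qed.

Lemma wsum_ex y u B : (forall j, Rabs (u j) <= B) ->
  ex_series (fun j => weight a b j y * u j).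
Proof.
  intros hu; apply (ex_series_le (V := R_CompleteNormedModule)) with (fun j => B * contraction ^ j).
  - intros n; apply (wsum_term_le y u B n hu).
  - apply geom_scal_ex.
Qed.

Lemma wsum_le y u B : (forall j, Rabs (u j) <= B) ->
  Rabs (wsum y u) <= B / (1 - contraction).
Proof.
  intros hu; unfold wsum.
  assert (hex : ex_series (fun j => Rabs (weight a b j y * u j))).
  { apply (ex_series_le (V := R_CompleteNormedModule)) with (fun j => B * contraction ^ j); [|apply geom_scal_ex].
    intros n; unfold norm; simpl; unfold abs; simpl; rewrite Rabs_Rabsolu.
    apply (wsum_term_le y u B n hu). }
  eapply Rle_trans; [apply Series_Rabs, hex|].
  eapply Rle_trans; [apply Series_le; [|apply (geom_scal_ex B)]|].
  - intros n; split; [apply Rabs_pos | apply wsum_term_le, hu].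
  - rewrite Series_scal_l, Series_geom; [unfold Rdiv; lra|].
    pose proof contraction_bounds; rewrite Rabs_pos_eq; lra.
Qed.

Lemma wsum_ext y u v : (forall j, u j = v j) -> wsum y u = wsum y v.
Proof. intros h; apply Series_ext; intros n; now rewrite h. Qed.

Lemma wsum_lin y u v B C k l :
  (forall j, Rabs (u j) <= B) -> (forall j, Rabs (v j) <= C) ->
  wsum y (fun j => k * u j + l * v j) = k * wsum y u + l * wsum y v.
Proof.
  intros hu hv; unfold wsum.
  rewrite <- !Series_scal_l, <- Series_plus.
  - apply Series_ext; intros n; ring.
  - apply (ex_series_scal_l k (fun j => weight a b j y * u j)), (wsum_ex y u B hu).
  - apply (ex_series_scal_l l (fun j => weight a b j y * v j)), (wsum_ex y v C hv).
Qed.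

Lemma wsum_scal y u k : wsum y (fun j => k * u j) = k * wsum y u.
Proof.
  unfold wsum; rewrite <- Series_scal_l; apply Series_ext; intros n; ring.
Qed.

(** The weights form a cocycle, so W_m factors out of the tail. With m = 1 this is the one-step
    recursion behind continuity in the parameter; with m a return time to the peak it becomes a
    self-similarity of the series. *)
Lemma wsum_shift y u B m : (forall j, Rabs (u j) <= B) ->
  (forall j, (1 <= j < m)%nat -> u j = 0) -> (0 < m)%nat ->
  wsum y u = u O + weight a b m y * wsum (iterT a b m y) (fun j => u (j + m)%nat).
Proof.
  intros hu h0 hm; unfold wsum.
  rewrite (Series_incr_n _ m hm (wsum_ex y u B hu)); f_equal.
  - destruct m as [|m]; [lia|]; simpl pred; clear hm.
    induction m as [|m IH]; [simpl; ring|].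
    simpl sum_f_R0; rewrite IH; [|intros; apply h0; lia].
    rewrite (h0 (S m)); [ring | lia].
  - rewrite <- Series_scal_l; apply Series_ext; intros n.
    rewrite (Nat.add_comm m n), weight_add; ring.
Qed.

(* Iterating [u j = e j + u (j+1) / slope_j] forward converges because the slopes expand. *)
Lemma wsum_telescope y u e B : (forall j, Rabs (u j) <= B) ->
  (forall j, u j = e j + u (S j) / slope a b (iterT a b j y)) ->
  wsum y e = u O.
Proof.
  intros hu hrec; apply is_series_unique.
  assert (hpart : forall n, sum_n (fun j => weight a b j y * e j) n
                            = u O - weight a b (S n) y * u (S n)).
  { intros n; induction n as [|n IH].
    - rewrite sum_O; simpl; rewrite (hrec O); simpl; field; apply slope_neq0.
    - rewrite sum_Sn, IH; unfold plus; simpl.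
      rewrite (hrec (S n)); simpl; field; repeat split; apply slope_neq0. }
  change (is_lim_seq (sum_n (fun j => weight a b j y * e j)) (u O)).
  apply (is_lim_seq_ext (fun n => u O - weight a b (S n) y * u (S n))).
  { intros n; symmetry; apply hpart. }
  replace (Finite (u O)) with (Finite (u O - 0)) by (f_equal; ring).
  apply is_lim_seq_minus'; [apply is_lim_seq_const|].
  apply is_lim_seq_abs_0.
  apply is_lim_seq_le_le with (fun _ => 0) (fun n => B * contraction ^ (S n)).
  - intros n; split; [apply Rabs_pos | apply wsum_term_le, hu].
  - apply is_lim_seq_const.
  - apply (is_lim_seq_incr_1 (fun n => B * contraction ^ n)).
    apply (ex_series_lim_0 _ (geom_scal_ex B)).
Qed.

Lemma Rabs_unit x : 0 <= x <= 1 -> Rabs x <= 1.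
Proof. intros; rewrite Rabs_pos_eq; lra. Qed.

Lemma right_ind_le x : Rabs (right_ind a x) <= 1.
Proof. apply Rabs_unit; unfold right_ind; destruct (Rle_dec x a); lra. Qed.

(** Telescoping [inverse_branch]: a point is the weighted sum of its own itinerary. *)
Lemma wsum_right_ind y : 0 <= y <= 1 ->
  wsum y (fun j => right_ind a (iterT a b j y)) = y.
Proof.
  intros hy; apply (wsum_telescope y (fun j => iterT a b j y) _ 1).
  - intros j; apply Rabs_unit, iterT_range, hy.
  - intros j; apply inverse_branch.
Qed.

(** On each branch an increment at stage n + 1 is an increment at stage n times the inverse slope,
    while T stretches lengths by the slope. A pair straddling [a] is split at [a]. The argument uses
    the recursion alone, before any measure is introduced. *)
Lemma sojourn_lipschitz t n y z : 0 <= t -> 0 <= y <= z -> z <= 1 ->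
  0 <= sojourn a b t n z - sojourn a b t n y <= z - y.
Proof.
  destruct inU_bounds as (ha & ha1 & hb & hb1 & _).
  intros ht; revert y z; induction n as [|n IH]; intros y z hy hz.
  { simpl; unfold Rmin; destruct (Rle_dec z t), (Rle_dec y t); lra. }
  set (g := sojourn a b t n) in *.
  assert (hL : forall x, x <= a -> sojourn a b t (S n) x = g (b / a * x) * (a / b)).
  { intros x hx; simpl; fold g; unfold slope, right_ind, T.
    destruct (Rle_dec x a); [field; lra | lra]. }
  (* This includes x = a, where [sojourn] unfolds along the left branch: both formulas give g b · a
     / b there. *)
  assert (hR : forall x, a <= x ->
    sojourn a b t (S n) x = g b / b - g (b / (1 - a) * (1 - x)) * ((1 - a) / b)).
  { intros x hx; simpl; fold g; unfold slope, right_ind, T.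
    destruct (Rle_dec x a) as [h|h]; [|field; lra].
    replace x with a by lra.
    replace (b / a * a) with b by (field; lra).
    replace (b / (1 - a) * (1 - a)) with b by (field; lra).
    field; lra. }
  assert (mL : forall x w, 0 <= x <= w -> w <= a ->
    0 <= sojourn a b t (S n) w - sojourn a b t (S n) x <= w - x).
  { intros x w hx hw; rewrite !hL; try lra.
    assert (hd : b / a * w - b / a * x = b / a * (w - x)) by ring.
    assert (hba : 0 < b / a) by (apply Rdiv_lt_0_compat; lra).
    assert (hab : 0 < a / b) by (apply Rdiv_lt_0_compat; lra).
    assert (hinv : b / a * (a / b) = 1) by (field; lra).
    assert (hw1 : b / a * w <= 1).
    { apply Rle_trans with (b / a * a); [apply Rmult_le_compat_l; lra|].
      replace (b / a * a) with b by (field; lra); lra. }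
    destruct (IH (b / a * x) (b / a * w)) as [i1 i2]; [nra | exact hw1 |].
    rewrite <- Rmult_minus_distr_r; split; [nra|].
    replace (w - x) with ((b / a * w - b / a * x) * (a / b)) by (field; lra); nra. }
  assert (mR : forall x w, a <= x <= w -> w <= 1 ->
    0 <= sojourn a b t (S n) w - sojourn a b t (S n) x <= w - x).
  { intros x w hx hw; rewrite !hR; try lra.
    assert (hba : 0 < b / (1 - a)) by (apply Rdiv_lt_0_compat; lra).
    assert (hab : 0 < (1 - a) / b) by (apply Rdiv_lt_0_compat; lra).
    assert (hw1 : b / (1 - a) * (1 - x) <= 1).
    { apply Rle_trans with (b / (1 - a) * (1 - a)); [apply Rmult_le_compat_l; lra|].
      replace (b / (1 - a) * (1 - a)) with b by (field; lra); lra. }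
    destruct (IH (b / (1 - a) * (1 - w)) (b / (1 - a) * (1 - x))) as [i1 i2];
      [nra | exact hw1 |].
    replace (w - x) with ((b / (1 - a) * (1 - x) - b / (1 - a) * (1 - w)) * ((1 - a) / b))
      by (field; lra).
    split; nra. }
  destruct (Rle_dec z a); [apply mL; lra|].
  destruct (Rle_dec a y); [apply mR; lra|].
  pose proof (mL y a ltac:(lra) ltac:(lra)); pose proof (mR a z ltac:(lra) ltac:(lra)); lra.
Qed.

Lemma sojourn_0 t n : 0 <= t -> sojourn a b t n 0 = 0.
Proof.
  destruct inU_bounds as (ha & _ & hb & _).
  intros ht; induction n as [|n IH]; simpl; [apply Rmin_left, ht|].
  unfold right_ind, T; destruct (Rle_dec 0 a); [|lra].
  rewrite Rmult_0_r, IH; field; split; [lra | apply slope_neq0].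
Qed.

Lemma sojourn_range t n y : 0 <= t -> 0 <= y <= 1 -> 0 <= sojourn a b t n y <= 1.
Proof.
  intros ht hy; pose proof (sojourn_lipschitz t n 0 y ht ltac:(lra) ltac:(lra)) as h.
  rewrite sojourn_0 in h; lra.
Qed.


Definition peak_orbit (j : nat) : R := iterT a b j b.

(* [wmin] is H and [wtotal] is Z. *)
Definition wmin (t : R) : R := wsum b (fun j => Rmin (peak_orbit j) t).

Definition wtotal : R := wsum b peak_orbit.

Lemma peak_orbit_range j : 0 <= peak_orbit j <= b.
Proof.
  destruct inU_bounds as (_ & _ & hb & _).
  apply iterT_le_peak; lra.
Qed.

Lemma peak_orbit_range1 j : 0 <= peak_orbit j <= 1.
Proof.
  destruct inU_bounds as (_ & _ & _ & hb & _).
  pose proof (peak_orbit_range j); lra.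
Qed.

(* Invariance of the (signed, unnormalised) measure with distribution function [wmin]. *)
Lemma wsum_sojourn t n : 0 <= t -> wsum b (fun j => sojourn a b t n (peak_orbit j)) = wmin t.
Proof.
  destruct inU_bounds as (_ & _ & hb & hb1 & _).
  intros ht; induction n as [|n IH]; [reflexivity|].
  rewrite <- IH; simpl sojourn; set (g := sojourn a b t n) in *.
  assert (hg : forall j, Rabs (g (peak_orbit j)) <= 1).
  { intros j; apply Rabs_unit, sojourn_range; [exact ht | apply peak_orbit_range1]. }
  assert (hr : wsum b (fun j => right_ind a (peak_orbit j)) = b)
    by (apply wsum_right_ind; lra).
  assert (h : wsum b (fun j => g (peak_orbit j) + -1 * (g (peak_orbit (S j)) / slope a b (peak_orbit j)))
              = g b).
  { apply (wsum_telescope b (fun j => g (peak_orbit j)) _ 1 hg).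
    intros j; unfold Rdiv; simpl; fold (peak_orbit j); ring. }
  assert (hq : forall j, Rabs (g (peak_orbit (S j)) / slope a b (peak_orbit j)) <= 1).
  { intros j; unfold Rdiv; rewrite Rabs_mult.
    pose proof (slope_inv_le (peak_orbit j)) as h1; pose proof contraction_bounds.
    pose proof (hg (S j)) as h2; pose proof (Rabs_pos (g (peak_orbit (S j)))).
    pose proof (Rabs_pos (/ slope a b (peak_orbit j))); nra. }
  pose proof (wsum_lin b (fun j => g (peak_orbit j))
    (fun j => g (peak_orbit (S j)) / slope a b (peak_orbit j)) 1 1 1 (-1) hg hq) as h'.
  rewrite (wsum_ext b _ (fun j => g (peak_orbit j)
    + -1 * (g (peak_orbit (S j)) / slope a b (peak_orbit j)))), h in h'; [|intros; ring].
  pose proof (wsum_lin b (fun j => g (peak_orbit (S j)) / slope a b (peak_orbit j))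
    (fun j => right_ind a (peak_orbit j)) 1 1 1 (g b / b) hq
    (fun j => right_ind_le _)) as h2.
  rewrite hr in h2.
  rewrite (wsum_ext b _ (fun j => 1 * (g (peak_orbit (S j)) / slope a b (peak_orbit j))
    + g b / b * right_ind a (peak_orbit j))), h2; [|intros j; simpl; fold (peak_orbit j); ring].
  replace (g b / b * b) with (g b) by (field; lra); lra.
Qed.

(** * Cesàro means of the sojourns *)

Definition sojourn_mean (t : R) (N : nat) (y : R) : R :=
  sum_f_R0 (fun n => sojourn a b t n y) N / INR (S N).

(** Summing the recursion over n shifts time by one, so only the boundary terms n = 0 and n = N + 1
    survive; dividing by N + 1 makes them small. *)
Lemma sojourn_mean_rec t N y : sojourn_mean t N y
  = (sojourn a b t 0 y - sojourn a b t (S N) y) / INR (S N)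
    + right_ind a y * (sojourn_mean t N b / b)
    + sojourn_mean t N (T a b y) / slope a b y.
Proof.
  destruct inU_bounds as (_ & _ & hb & _).
  assert (hsum : sum_f_R0 (fun n => sojourn a b t n y) N
    = sojourn a b t 0 y - sojourn a b t (S N) y
      + right_ind a y * (sum_f_R0 (fun n => sojourn a b t n b) N / b)
      + sum_f_R0 (fun n => sojourn a b t n (T a b y)) N / slope a b y).
  { induction N as [|N IH].
    - simpl; field; split; lra || apply slope_neq0.
    - rewrite !tech5, IH.
      change (sojourn a b t (S (S N)) y) with (sojourn a b t (S N) (T a b y) / slope a b y
        + right_ind a y * (sojourn a b t (S N) b / b)).
      field; split; lra || apply slope_neq0. }
  unfold sojourn_mean; rewrite hsum.
  field; repeat split; lra || apply slope_neq0 || (apply not_0_INR; lia).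
Qed.

Lemma sum_f_R0_bounds f B N : (forall n, 0 <= f n <= B) ->
  0 <= sum_f_R0 f N <= B * INR (S N).
Proof.
  intros hf; induction N as [|N IH].
  - simpl; pose proof (hf O); lra.
  - rewrite tech5, (S_INR (S N)); pose proof (hf (S N)); lra.
Qed.

Lemma sojourn_mean_range t N y : 0 <= t -> 0 <= y <= 1 -> 0 <= sojourn_mean t N y <= 1.
Proof.
  intros ht hy.
  pose proof (sum_f_R0_bounds (fun n => sojourn a b t n y) 1 N
    (fun n => sojourn_range t n y ht hy)).
  assert (0 < INR (S N)) by (apply lt_0_INR; lia).
  unfold sojourn_mean; split; [apply Rdiv_le_0_compat; lra | apply Rle_div_l; lra].
Qed.

(** By telescoping, the mean is Σ W_j (err_j + m right_ind_j), and [wsum_right_ind] sums the second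
    part to m y. The geometric series bounds the rest by 1 / (1 - contraction) times the size of
    [err]. *)
Lemma sojourn_mean_linear t N y : 0 <= t -> 0 <= y <= 1 ->
  Rabs (sojourn_mean t N y - y * (sojourn_mean t N b / b))
  <= / (1 - contraction) / INR (S N).
Proof.
  destruct inU_bounds as (_ & _ & hb & hb1 & _).
  intros ht hy; set (m := sojourn_mean t N b / b).
  set (err := fun j => (sojourn a b t 0 (iterT a b j y) - sojourn a b t (S N) (iterT a b j y))
                       / INR (S N)).
  assert (hN : 0 < INR (S N)) by (apply lt_0_INR; lia).
  assert (herr : forall j, Rabs (err j) <= / INR (S N)).
  { intros j; unfold err, Rdiv; rewrite Rabs_mult, (Rabs_pos_eq (/ INR (S N)));
      [|left; apply Rinv_0_lt_compat, hN].
    rewrite <- (Rmult_1_l (/ INR (S N))) at 2; apply Rmult_le_compat_r;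
      [left; apply Rinv_0_lt_compat, hN|].
    pose proof (iterT_range j y hy) as hj.
    pose proof (sojourn_range t 0 _ ht hj); pose proof (sojourn_range t (S N) _ ht hj).
    apply Rabs_le; lra. }
  assert (h : wsum y (fun j => 1 * err j + m * right_ind a (iterT a b j y)) = sojourn_mean t N y).
  { apply (wsum_telescope y (fun j => sojourn_mean t N (iterT a b j y)) _ 1).
    - intros j; apply Rabs_unit, sojourn_mean_range; [exact ht | apply iterT_range, hy].
    - intros j; simpl iterT; fold (iterT a b j y).
      rewrite (sojourn_mean_rec t N (iterT a b j y)); unfold err, m; ring. }
  rewrite (wsum_lin y err _ _ 1 1 m herr (fun j => right_ind_le _)) in h.
  rewrite (wsum_right_ind y hy) in h.
  replace (sojourn_mean t N y - y * m) with (wsum y err) by lra.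
  replace (/ (1 - contraction) / INR (S N)) with (/ INR (S N) / (1 - contraction))
    by (unfold Rdiv; ring).
  apply wsum_le, herr.
Qed.

(** [wsum_sojourn] gives the same value for every n, hence for the mean over n. Replacing each mean
    by its linear approximation leaves m Σ W_j X_j. One factor 1 / (1 - contraction) comes from that
    approximation, the other from summing it with the weights. *)
Lemma wmin_mean t N : 0 <= t ->
  Rabs (wmin t - wtotal * (sojourn_mean t N b / b))
  <= / (1 - contraction) / INR (S N) / (1 - contraction).
Proof.
  destruct inU_bounds as (_ & _ & hb & hb1 & _).
  intros ht; set (m := sojourn_mean t N b / b).
  assert (hN : 0 < INR (S N)) by (apply lt_0_INR; lia).
  assert (h : wsum b (fun j => sojourn_mean t N (peak_orbit j)) = wmin t).
  { assert (hs : forall n, wsum b (fun j => sum_f_R0 (fun k => sojourn a b t k (peak_orbit j)) n)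
                           = INR (S n) * wmin t).
    { intros n; induction n as [|n IH].
      - change (wsum b (fun j => sojourn a b t 0 (peak_orbit j)) = INR 1 * wmin t).
        rewrite (wsum_sojourn t 0 ht); simpl; ring.
      - rewrite (wsum_ext b _ (fun j => 1 * sum_f_R0 (fun k => sojourn a b t k (peak_orbit j)) n
            + 1 * sojourn a b t (S n) (peak_orbit j))) by (intros j; rewrite tech5; ring).
        rewrite (wsum_lin b _ _ (1 * INR (S n)) 1).
        + rewrite IH, (wsum_sojourn t (S n) ht), (S_INR (S n)); ring.
        + intros j.
          pose proof (sum_f_R0_bounds (fun k => sojourn a b t k (peak_orbit j)) 1 n
            (fun k => sojourn_range t k _ ht (peak_orbit_range1 j))).
          rewrite Rabs_pos_eq; lra.
        + intros j; apply Rabs_unit, sojourn_range; [exact ht | apply peak_orbit_range1]. }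
    rewrite (wsum_ext b _ (fun j => / INR (S N)
      * sum_f_R0 (fun k => sojourn a b t k (peak_orbit j)) N)).
    - rewrite wsum_scal, hs; field; lra.
    - intros j; unfold sojourn_mean, Rdiv; ring. }
  rewrite <- h; unfold wtotal; rewrite (Rmult_comm _ m).
  pose proof (wsum_lin b (fun j => sojourn_mean t N (peak_orbit j)) peak_orbit 1 1 1 (- m)
    (fun j => Rabs_unit _ (sojourn_mean_range t N _ ht (peak_orbit_range1 j)))
    (fun j => Rabs_unit _ (peak_orbit_range1 j))) as hl.
  match goal with |- Rabs ?x <= _ => replace x with
    (1 * wsum b (fun j => sojourn_mean t N (peak_orbit j)) + - m * wsum b peak_orbit) by ring end.
  rewrite <- hl; apply wsum_le; intros j.
  replace (1 * sojourn_mean t N (peak_orbit j) + - m * peak_orbit j)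
    with (sojourn_mean t N (peak_orbit j) - peak_orbit j * m) by ring.
  apply sojourn_mean_linear; [exact ht | apply peak_orbit_range1].
Qed.

Lemma lim_div_succ c : is_lim_seq (fun N => c / INR (S N)) 0.
Proof.
  apply (is_lim_seq_incr_1 (fun N => c / INR N)).
  replace (Finite 0) with (Rbar_mult c 0) by (simpl; f_equal; ring).
  apply is_lim_seq_scal_l.
  replace (Finite 0) with (Rbar_inv p_infty) by reflexivity.
  apply is_lim_seq_inv; [apply is_lim_seq_INR | discriminate].
Qed.

(** [wtotal] stands as a factor and not as a divisor, because this limit is itself used to prove
    [wtotal_neq0]. *)
Lemma wtotal_sojourn_lim t : 0 <= t ->
  is_lim_seq (fun N => wtotal * (sojourn_mean t N b / b)) (wmin t).
Proof.
  intros ht.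
  apply is_lim_seq_ext with
    (fun N => wmin t - (wmin t - wtotal * (sojourn_mean t N b / b))); [intros; ring|].
  replace (Finite (wmin t)) with (Finite (wmin t - 0)) by (f_equal; ring).
  apply is_lim_seq_minus'; [apply is_lim_seq_const|].
  apply is_lim_seq_abs_0.
  apply is_lim_seq_le_le with (fun _ => 0)
    (fun N => / (1 - contraction) / (1 - contraction) / INR (S N)).
  - intros N; split; [apply Rabs_pos|].
    replace (/ (1 - contraction) / (1 - contraction) / INR (S N))
      with (/ (1 - contraction) / INR (S N) / (1 - contraction)) by (unfold Rdiv; ring).
    apply wmin_mean, ht.
  - apply is_lim_seq_const.
  - apply lim_div_succ.
Qed.

(** The first return time to [b], truncated at [J]; the alternative [m = J] covers orbits that have
    not come back earlier. *)
Lemma peak_first_return : forall J, (1 <= J)%nat -> exists m, (1 <= m <= J)%nat /\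
  (forall j, (1 <= j < m)%nat -> peak_orbit j < b) /\ (m = J \/ peak_orbit m = b).
Proof.
  intros J hJ; induction J as [|J IH]; [lia|].
  destruct J as [|J].
  { exists 1%nat; split; [lia | split; [intros; lia | now left]]. }
  destruct IH as (m & hm & hlt & [-> | heq]); [lia | |].
  - destruct (Req_dec (peak_orbit (S J)) b) as [h|h].
    + exists (S J); split; [lia | auto].
    + exists (S (S J)); split; [lia | split; [|now left]].
      intros j hj; destruct (Nat.eq_dec j (S J)) as [->|hne]; [|apply hlt; lia].
      pose proof (peak_orbit_range (S J)); lra.
  - exists m; split; [lia | auto].
Qed.

(** A non-returning orbit may accumulate at [b], so a gap is available only for finitely many
    times. *)
Lemma finite_gap m : (forall j, (1 <= j < m)%nat -> peak_orbit j < b) ->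
  exists eps, 0 < eps < b /\ forall j, (1 <= j < m)%nat -> peak_orbit j <= b - eps.
Proof.
  destruct inU_bounds as (_ & _ & hb & _).
  induction m as [|m IH]; intros h.
  { exists (b / 2); split; [lra | intros; lia]. }
  destruct IH as (eps & he & hle); [intros; apply h; lia|].
  destruct m as [|m].
  { exists eps; split; [exact he | intros; lia]. }
  exists (Rmin eps (b - peak_orbit (S m))); split.
  - pose proof (h (S m) ltac:(lia)); split; [apply Rmin_glb_lt; lra|].
    eapply Rle_lt_trans; [apply Rmin_l | lra].
  - intros j hj; destruct (Nat.eq_dec j (S m)) as [->|hne].
    + pose proof (Rmin_r eps (b - peak_orbit (S m))); lra.
    + pose proof (hle j ltac:(lia)); pose proof (Rmin_l eps (b - peak_orbit (S m))); lra.
Qed.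

(* If the total mass vanished, so would [wmin]; but [wmin] has a kink at [b]: the terms of
   the orbit returning to [b] contribute a nonzero geometric series, and the others are
   negligible. *)
Lemma wtotal_neq0 : wtotal <> 0.
Proof.
  destruct inU_bounds as (_ & _ & hb & hb1 & _).
  pose proof contraction_bounds as hc.
  intros h0.
  assert (hmin : forall t, 0 <= t -> wmin t = 0).
  { intros t ht; pose proof (wtotal_sojourn_lim t ht) as hl.
    apply is_lim_seq_ext with (v := fun _ => 0) in hl; [|intros; rewrite h0; ring].
    apply is_lim_seq_unique in hl; rewrite Lim_seq_const in hl; now inversion hl. }
  (* Beyond this [J], the tail bound contraction^n / (1 - contraction) is below 1. *)
  destruct (pow_lt_1_zero contraction) with (y := 1 - contraction) as [J hJ];
    [rewrite Rabs_pos_eq; lra | lra |].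
  specialize (hJ (S J) ltac:(lia)).
  destruct (peak_first_return (S J)) as (m & hm & hlt & hcase); [lia|].
  destruct (finite_gap m hlt) as (eps & he & hgap).
  (* A ramp in the orbit point, 0 up to b - eps and 1 at [b]. Its weighted sum is (wtotal - wmin (b
     - eps)) / eps, hence 0 here. *)
  set (v := fun j => / eps * (peak_orbit j - Rmin (peak_orbit j) (b - eps))).
  assert (hie : 0 < / eps) by (apply Rinv_0_lt_compat; lra).
  assert (hv : forall j, 0 <= v j <= 1).
  { intros j; unfold v; pose proof (peak_orbit_range j).
    assert (hd : 0 <= peak_orbit j - Rmin (peak_orbit j) (b - eps) <= eps)
      by (unfold Rmin; destruct (Rle_dec (peak_orbit j) (b - eps)); lra).
    split; [nra|].
    replace 1 with (/ eps * eps) by (field; lra); nra. }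
  assert (hv1 : forall j, Rabs (v j) <= 1) by (intros; apply Rabs_unit, hv).
  assert (hv0 : v O = 1).
  { unfold v, peak_orbit; simpl; rewrite Rmin_right; [field|]; lra. }
  assert (hvz : forall j, (1 <= j < m)%nat -> v j = 0).
  { intros j hj; unfold v; rewrite Rmin_left; [ring | auto]. }
  assert (hvs : wsum b v = 0).
  { unfold v; rewrite wsum_scal.
    rewrite (wsum_ext b _ (fun j => 1 * peak_orbit j + -1 * Rmin (peak_orbit j) (b - eps)));
      [|intros; ring].
    rewrite (wsum_lin b _ _ 1 1).
    - fold wtotal; fold (wmin (b - eps)); rewrite h0, hmin; lra.
    - intros j; apply Rabs_unit, peak_orbit_range1.
    - intros j; apply Rabs_unit; pose proof (peak_orbit_range1 j).
      unfold Rmin; destruct (Rle_dec (peak_orbit j) (b - eps)); lra. }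
  pose proof (wsum_shift b v 1 m hv1 hvz ltac:(lia)) as heq.
  rewrite hv0 in heq.
  (* After a return the tail is again wsum b v = 0, and the splitting reads 0 = 1 + 0. Without a
     return the tail has absolute value below 1 and cannot cancel v 0 = 1. *)
  destruct (Req_dec (peak_orbit m) b) as [hret|hnret].
  - unfold peak_orbit in hret; rewrite hret in heq.
    rewrite (wsum_ext b (fun j => v (j + m)%nat) v), hvs in heq; [lra|].
    intros j; unfold v, peak_orbit; now rewrite iterT_add, hret.
  - destruct hcase as [-> | h]; [|now apply hnret].
    assert (hle : Rabs (weight a b (S J) b
        * wsum (iterT a b (S J) b) (fun j => v (j + S J)%nat)) < 1).
    { rewrite Rabs_mult.
      pose proof (weight_le (S J) b) as h1.
      pose proof (wsum_le (iterT a b (S J) b) (fun j => v (j + S J)%nat) 1 (fun j => hv1 _)) as h2.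
      rewrite Rabs_pos_eq in hJ; [|apply pow_le; lra].
      apply Rle_lt_trans with (contraction ^ S J * (1 / (1 - contraction))).
      - apply Rmult_le_compat; auto using Rabs_pos.
      - unfold Rdiv; rewrite Rmult_1_l; apply Rlt_div_l; lra. }
    apply Rabs_def2 in hle; lra.
Qed.

Lemma sojourn_mean_lim t y : 0 <= t -> 0 <= y <= 1 ->
  is_lim_seq (fun N => sojourn_mean t N y) (y * (wmin t / wtotal)).
Proof.
  intros ht hy; pose proof wtotal_neq0 as hZ.
  apply is_lim_seq_ext with
    (fun N => (sojourn_mean t N y - y * (sojourn_mean t N b / b))
              + y * (/ wtotal * (wtotal * (sojourn_mean t N b / b)))).
  { intros N; replace (/ wtotal * (wtotal * (sojourn_mean t N b / b)))
      with (/ wtotal * wtotal * (sojourn_mean t N b / b)) by ring.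
    rewrite Rinv_l; [ring | exact hZ]. }
  replace (Finite (y * (wmin t / wtotal))) with (Finite (0 + y * (/ wtotal * wmin t)))
    by (f_equal; unfold Rdiv; ring).
  apply is_lim_seq_plus'.
  - apply is_lim_seq_abs_0.
    apply is_lim_seq_le_le with (fun _ => 0) (fun N => / (1 - contraction) / INR (S N)).
    + intros N; split; [apply Rabs_pos | apply sojourn_mean_linear; assumption].
    + apply is_lim_seq_const.
    + apply lim_div_succ.
  - apply (is_lim_seq_scal_l _ y (/ wtotal * wmin t)).
    apply (is_lim_seq_scal_l _ (/ wtotal) (wmin t)).
    apply wtotal_sojourn_lim, ht.
Qed.

End Orbits.

(** * The isentrope *)

Lemma isC_SC s : isC s = true -> s = SC.
Proof. now destruct s. Qed.

Lemma ext_knead_SC a b n : ext_knead a b n = SC -> iterT a b n a = a.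
Proof.
  unfold ext_knead; destruct (total_order_T (iterT a b n a) a) as [[h|h]|h]; congruence.
Qed.

Lemma ext_knead_side a b n : iterT a b n a <= a <-> ext_knead a b n <> SR.
Proof.
  unfold ext_knead; destruct (total_order_T (iterT a b n a) a) as [[h|h]|h];
    split; intros; try discriminate; try lra; now exfalso.
Qed.

Lemma stopped_first a b k : stopped a b k = true ->
  exists i, (i < k)%nat /\ stopped a b i = false /\ ext_knead a b (S i) = SC.
Proof.
  induction k as [|k IH]; simpl; [discriminate|].
  destruct (stopped a b k) eqn:hk; simpl.
  - intros _; destruct (IH eq_refl) as (i & hi & h); exists i; split; [lia | exact h].
  - intros hC; exists k; split; [lia | split; [exact hk | now apply isC_SC]].
Qed.

(* After the first return to the turning point the orbit is periodic, so even a finite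
   kneading sequence determines on which side of the turning point all iterates lie. *)
Lemma knead_eq_side a b a' b' : knead_eq a' b' a b ->
  forall n, iterT a' b' (S n) a' <= a' <-> iterT a b (S n) a <= a.
Proof.
  intros hK n; induction n as [n IH] using lt_wf_ind.
  pose proof (hK (S n)) as h; unfold K in h.
  destruct (stopped a b n) eqn:hs.
  - destruct (stopped_first a b n hs) as (i & hi & hns & hC).
    pose proof (hK (S i)) as h'; unfold K in h'; rewrite hns, hC in h'.
    destruct (stopped a' b' i); [discriminate|].
    assert (hC' : ext_knead a' b' (S i) = SC) by congruence.
    apply ext_knead_SC in hC; apply ext_knead_SC in hC'.
    replace (S n) with (S (n - S i) + S i)%nat by lia.
    rewrite !iterT_add, hC, hC'; apply IH; lia.
  - destruct (stopped a' b' n); [discriminate|].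
    rewrite !ext_knead_side; now replace (ext_knead a' b' (S n)) with (ext_knead a b (S n)) by congruence.
Qed.

(** Only the branch used by [T] is recorded, so [SL] and [SC] are merged; finite and infinite
    kneading sequences can then be treated alike. *)
Definition same_sides (a b a' b' : R) : Prop :=
  forall j, peak_orbit a' b' j <= a' <-> peak_orbit a b j <= a.

Lemma knead_eq_same_sides a b a' b' : inU a b -> inU a' b' ->
  knead_eq a' b' a b -> same_sides a b a' b'.
Proof.
  intros hU hU' hK j; pose proof (knead_eq_side a b a' b' hK j) as h.
  now rewrite !iterT_succ_r, !T_turning in h.
Qed.

Section Derivative.

Variables a b : R.
Hypothesis HU : inU a b.

Definition wshift : R := wsum a b b (fun j => peak_orbit a b (S j)).

(* [b Y_j - b' X_j] telescopes along two orbits [X], [Y] with a common itinerary, and vanishes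
   at [j = 0]. *)
Lemma isentrope_increment a' b' : inU a' b' -> same_sides a b a' b' ->
  (b' - b) * wsum a b b (peak_orbit a' b')
  = (a' - a) * wsum a b b (fun j => peak_orbit a' b' (S j)).
Proof.
  intros hU' hs.
  destruct (inU_bounds a b HU) as (ha & ha1 & hb & hb1 & _).
  destruct (inU_bounds a' b' hU') as (ha' & ha1' & hb' & hb1' & _).
  pose proof (peak_orbit_range1 a b HU) as hX.
  pose proof (peak_orbit_range1 a' b' hU') as hY.
  assert (h : wsum a b b (fun j => (a' - a) * peak_orbit a' b' (S j)
                                 + (- (b' - b)) * peak_orbit a' b' j) = 0).
  { transitivity (b * peak_orbit a' b' 0 - b' * peak_orbit a b 0);
      [|unfold peak_orbit; simpl; ring].
    apply (wsum_telescope a b HU b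
             (fun j => b * peak_orbit a' b' j - b' * peak_orbit a b j) _ 1).
    - intros j; specialize (hX j); specialize (hY j); apply Rabs_le; nra.
    - intros j; fold (peak_orbit a b j).
      change (peak_orbit a' b' (S j)) with (T a' b' (peak_orbit a' b' j)).
      change (peak_orbit a b (S j)) with (T a b (peak_orbit a b j)).
      specialize (hs j); unfold slope, T.
      destruct (Rle_dec (peak_orbit a b j) a) as [h|h];
        destruct (Rle_dec (peak_orbit a' b' j) a') as [h'|h'];
        try (exfalso; tauto); field; repeat split; lra. }
  rewrite (wsum_lin a b HU b _ _ 1 1) in h.
  - lra.
  - intros j; apply Rabs_unit, hY.
  - intros j; apply Rabs_unit, hY.
Qed.

(** Induction on [J] peels off one term, continuous in [x], and passes to the base point [T a b y]
    with [u] shifted; the tail left at the end is bounded uniformly. Half of [eps] goes to the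
    peeled term, and the other half is only multiplied by a weight below 1. The weights stay those
    of the base parameter: only [u] moves with [x]. *)
Lemma wsum_continuity_aux x0 d0 B : 0 < d0 ->
  forall J y (u : R -> nat -> R),
  (forall x j, Rabs (x - x0) < d0 -> Rabs (u x j) <= B) ->
  (forall j, continuity_pt (fun x => u x j) x0) ->
  forall eps, 0 < eps -> exists delta, 0 < delta /\
    forall x, Rabs (x - x0) < delta ->
      Rabs (wsum a b y (u x) - wsum a b y (u x0))
      <= eps + 2 * B / (1 - contraction a b) * contraction a b ^ J.
Proof.
  pose proof (contraction_bounds a b HU) as hc.
  intros hd0; set (q := contraction a b) in *.
  assert (h0 : Rabs (x0 - x0) < d0) by (rewrite Rminus_diag, Rabs_R0; exact hd0).
  induction J as [|J IH]; intros y u hB hcont eps heps.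
  - exists d0; split; [exact hd0|]; intros x hx; simpl.
    pose proof (wsum_le a b HU y (u x) B (fun j => hB x j hx)) as h1.
    pose proof (wsum_le a b HU y (u x0) B (fun j => hB x0 j h0)) as h2.
    fold q in h1, h2.
    pose proof (Rabs_triang (wsum a b y (u x)) (- wsum a b y (u x0))) as h3.
    rewrite Rabs_Ropp in h3.
    replace (2 * B / (1 - q) * 1) with (B / (1 - q) + B / (1 - q)) by (field; lra).
    unfold Rminus at 1; lra.
  - destruct (IH (T a b y) (fun x j => u x (S j))
      (fun x j hx => hB x (S j) hx) (fun j => hcont (S j)) (eps / 2) ltac:(lra))
      as (d1 & hd1 & h1).
    destruct (hcont O (eps / 2) ltac:(lra)) as (d2 & hd2 & h2).
    simpl in h2; unfold Rdist in h2.
    exists (Rmin d0 (Rmin d1 d2)); split; [now repeat apply Rmin_glb_lt|].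
    intros x hx.
    assert (hx0 : Rabs (x - x0) < d0) by (eapply Rlt_le_trans; [exact hx | apply Rmin_l]).
    assert (hx1 : Rabs (x - x0) < d1)
      by (eapply Rlt_le_trans; [exact hx | eapply Rle_trans; [apply Rmin_r | apply Rmin_l]]).
    assert (hx2 : Rabs (x - x0) < d2)
      by (eapply Rlt_le_trans; [exact hx | eapply Rle_trans; [apply Rmin_r | apply Rmin_r]]).
    specialize (h1 x hx1).
    assert (h2' : Rabs (u x O - u x0 O) <= eps / 2).
    { destruct (Req_dec x x0) as [->|hne]; [rewrite Rminus_diag, Rabs_R0; lra|].
      left; apply h2; split; [|exact hx2].
      split; [exact I | now apply not_eq_sym]. }
    rewrite (wsum_shift a b HU y (u x) B 1 (fun j => hB x j hx0) ltac:(intros; lia) ltac:(lia)).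
    rewrite (wsum_shift a b HU y (u x0) B 1 (fun j => hB x0 j h0) ltac:(intros; lia) ltac:(lia)).
    rewrite (wsum_ext a b (iterT a b 1 y) (fun j => u x (j + 1)%nat) (fun j => u x (S j)))
      by (intros; f_equal; lia).
    rewrite (wsum_ext a b (iterT a b 1 y) (fun j => u x0 (j + 1)%nat) (fun j => u x0 (S j)))
      by (intros; f_equal; lia).
    change (iterT a b 1 y) with (T a b y).
    set (s := wsum a b (T a b y) (fun j => u x (S j))) in *.
    set (s0 := wsum a b (T a b y) (fun j => u x0 (S j))) in *.
    replace (u x 0%nat + weight a b 1 y * s - (u x0 0%nat + weight a b 1 y * s0))
      with ((u x 0%nat - u x0 0%nat) + weight a b 1 y * (s - s0)) by ring.
    eapply Rle_trans; [apply Rabs_triang|].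
    rewrite Rabs_mult; pose proof (weight_le a b HU 1 y) as hw; fold q in hw.
    simpl pow in *; rewrite Rmult_1_r in hw.
    assert (Rabs (weight a b 1 y) * Rabs (s - s0)
            <= q * (eps / 2 + 2 * B / (1 - q) * q ^ J))
      by (apply Rmult_le_compat; auto using Rabs_pos).
    nra.
Qed.

Lemma wsum_continuity x0 d0 B y (u : R -> nat -> R) : 0 < d0 ->
  (forall x j, Rabs (x - x0) < d0 -> Rabs (u x j) <= B) ->
  (forall j, continuity_pt (fun x => u x j) x0) ->
  continuity_pt (fun x => wsum a b y (u x)) x0.
Proof.
  pose proof (contraction_bounds a b HU) as hc.
  intros hd0 hB hcont eps heps.
  set (C := 2 * B / (1 - contraction a b)).
  assert (hC : 0 < Rabs C + 1) by (pose proof (Rabs_pos C); lra).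
  destruct (pow_lt_1_zero (contraction a b)) with (y := eps / 3 / (Rabs C + 1)) as [J hJ];
    [rewrite Rabs_pos_eq; lra | apply Rdiv_lt_0_compat; lra |].
  specialize (hJ J (Nat.le_refl J)).
  destruct (wsum_continuity_aux x0 d0 B hd0 J y u hB hcont (eps / 3) ltac:(lra)) as (d & hd & h).
  exists d; split; [exact hd|]; intros x [_ hx]; simpl in *; unfold Rdist in *.
  specialize (h x hx); fold C in h.
  rewrite Rabs_pos_eq in hJ; [|apply pow_le; lra].
  assert (C * contraction a b ^ J <= eps / 3).
  { apply Rle_trans with ((Rabs C + 1) * (eps / 3 / (Rabs C + 1))).
    - apply Rle_trans with ((Rabs C + 1) * contraction a b ^ J).
      + apply Rmult_le_compat_r; [apply pow_le; lra|].
        pose proof (Rle_abs C); lra.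
      + apply Rmult_le_compat_l; lra.
    - right; field; lra. }
  lra.
Qed.

(** The peak orbit for parameters (x, y), computed with the branches prescribed by the itinerary of
    (a, b). With the branches frozen it is rational in (x, y), so its continuity along the isentrope
    is immediate even if the orbit meets the turning point. *)
Fixpoint itinerary_point (j : nat) (x y : R) : R :=
  match j with
  | O => y
  | S k => if Rle_dec (peak_orbit a b k) a
           then y / x * itinerary_point k x y
           else y / (1 - x) * (1 - itinerary_point k x y)
  end.

Lemma itinerary_point_orbit a' b' j : same_sides a b a' b' ->
  itinerary_point j a' b' = peak_orbit a' b' j.
Proof.
  intros hs; induction j as [|j IH]; [reflexivity|].
  simpl; change (peak_orbit a' b' (S j)) with (T a' b' (peak_orbit a' b' j)).
  rewrite IH; unfold T; specialize (hs j).
  destruct (Rle_dec (peak_orbit a b j) a), (Rle_dec (peak_orbit a' b' j) a'); tauto.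
Qed.

Lemma itinerary_point_continuity (Psi : R -> R) j : continuity_pt Psi a ->
  continuity_pt (fun x => itinerary_point j x (Psi x)) a.
Proof.
  destruct (inU_bounds a b HU) as (ha & ha1 & _).
  intros hP; induction j as [|j IH]; [exact hP|]; simpl.
  assert (hid : continuity_pt (fun x => x) a) by (apply derivable_continuous_pt, derivable_pt_id).
  assert (hc : forall c : R, continuity_pt (fun _ => c) a)
    by (intros c; apply continuity_pt_const; now intros ? ?).
  destruct (Rle_dec (peak_orbit a b j) a).
  - apply (continuity_pt_mult (fun x => Psi x / x)); [|exact IH].
    apply (continuity_pt_div Psi (fun x => x)); auto; lra.
  - apply (continuity_pt_mult (fun x => Psi x / (1 - x)) (fun x => 1 - itinerary_point j x (Psi x))).
    + apply (continuity_pt_div Psi (fun x => 1 - x)); [exact hP | | lra].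
      apply (continuity_pt_minus (fun _ => 1) (fun x => x)); auto.
    + apply (continuity_pt_minus (fun _ => 1) (fun x => itinerary_point j x (Psi x))); auto.
Qed.

(** [isentrope_increment] makes the difference quotient equal to num / den exactly, so
    differentiability of Ψ reduces to continuity of this quotient at [a]. *)
Lemma isentrope_derivative (Psi : R -> R) d0 : 0 < d0 ->
  (forall x, Rabs (x - a) < d0 -> inU x (Psi x) /\ same_sides a b x (Psi x)) ->
  Psi a = b -> continuity_pt Psi a ->
  derivable_pt_lim Psi a (wshift / wtotal a b).
Proof.
  intros hd0 hnear hPa hcont.
  set (num := fun x => wsum a b b (fun j => itinerary_point (S j) x (Psi x))).
  set (den := fun x => wsum a b b (fun j => itinerary_point j x (Psi x))).
  assert (hbound : forall x j, Rabs (x - a) < d0 -> Rabs (itinerary_point j x (Psi x)) <= 1).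
  { intros x j hx; destruct (hnear x hx) as [hU hs].
    rewrite itinerary_point_orbit by exact hs.
    apply Rabs_unit, peak_orbit_range1, hU. }
  assert (hnum : continuity_pt num a).
  { apply (wsum_continuity a d0 1 b (fun x j => itinerary_point (S j) x (Psi x)) hd0).
    - intros x j; apply (hbound x (S j)).
    - intros j; apply itinerary_point_continuity, hcont. }
  assert (hden : continuity_pt den a).
  { apply (wsum_continuity a d0 1 b (fun x j => itinerary_point j x (Psi x)) hd0 hbound).
    intros j; apply itinerary_point_continuity, hcont. }
  assert (hna : num a = wshift /\ den a = wtotal a b).
  { assert (hs : same_sides a b a (Psi a)) by (rewrite hPa; intros j; tauto).
    unfold num, den, wshift, wtotal; split; apply wsum_ext; intros j;
      rewrite itinerary_point_orbit by exact hs; now rewrite hPa. }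
  destruct hna as [hna hda].
  pose proof (wtotal_neq0 a b HU) as hZ.
  assert (hquot : continuity_pt (fun x => num x / den x) a)
    by (apply continuity_pt_div; [exact hnum | exact hden | rewrite hda; exact hZ]).
  assert (hrel : forall x, Rabs (x - a) < d0 -> (Psi x - b) * den x = (x - a) * num x).
  { intros x hx; destruct (hnear x hx) as [hU hs].
    pose proof (isentrope_increment x (Psi x) hU hs) as h.
    unfold num, den.
    rewrite (wsum_ext a b b _ (peak_orbit x (Psi x)))
      by (intros; now apply itinerary_point_orbit).
    rewrite (wsum_ext a b b (fun j => itinerary_point (S j) x (Psi x))
      (fun j => peak_orbit x (Psi x) (S j)))
      by (intros; now apply itinerary_point_orbit).
    exact h. }
  intros eps heps.
  destruct (hquot eps heps) as (d1 & hd1 & h1).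
  (* Taking |Z| itself as tolerance keeps [den] away from 0 near [a]. *)
  destruct (hden (Rabs (wtotal a b)) (Rabs_pos_lt _ hZ)) as (d2 & hd2 & h2).
  simpl in h1, h2; unfold Rdist in h1, h2.
  assert (hd : 0 < Rmin d0 (Rmin d1 d2)) by (now repeat apply Rmin_glb_lt).
  exists (mkposreal _ hd); simpl; intros h hne hh.
  assert (hx : Rabs (a + h - a) = Rabs h) by (f_equal; ring).
  assert (hx0 : Rabs (a + h - a) < d0)
    by (rewrite hx; eapply Rlt_le_trans; [exact hh | apply Rmin_l]).
  assert (hx1 : Rabs (a + h - a) < d1)
    by (rewrite hx; eapply Rlt_le_trans; [exact hh | eapply Rle_trans; [apply Rmin_r | apply Rmin_l]]).
  assert (hx2 : Rabs (a + h - a) < d2)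
    by (rewrite hx; eapply Rlt_le_trans; [exact hh | eapply Rle_trans; [apply Rmin_r | apply Rmin_r]]).
  assert (hD : D_x no_cond a (a + h)) by (split; [exact I | lra]).
  specialize (h1 _ (conj hD hx1)); specialize (h2 _ (conj hD hx2)).
  rewrite hna, hda in h1; rewrite hda in h2.
  specialize (hrel _ hx0).
  assert (hden0 : den (a + h) <> 0).
  { intros h0; rewrite h0, Rminus_0_l, Rabs_Ropp in h2; lra. }
  rewrite hPa.
  replace ((Psi (a + h) - b) / h) with (num (a + h) / den (a + h)); [exact h1|].
  apply (Rmult_eq_reg_r (den (a + h) * h)); [|apply Rmult_integral_contrapositive_currified; assumption].
  transitivity (h * num (a + h)); [field; assumption|].
  transitivity ((Psi (a + h) - b) * den (a + h)); [rewrite hrel; ring | field; assumption].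
Qed.

(** Holds term by term, from min(x, a) = a (1 - a) / b · T x + a x: on the left the right side is (1
    - a) x + a x, on the right it is a (1 - x) + a x. *)
Lemma frequency_formula :
  a * (1 - a) * (wshift / wtotal a b / b) + a = wmin a b a / wtotal a b.
Proof.
  destruct (inU_bounds a b HU) as (ha & ha1 & hb & _).
  pose proof (wtotal_neq0 a b HU) as hZ.
  assert (h : wmin a b a = a * (1 - a) / b * wshift + a * wtotal a b).
  { unfold wmin, wshift, wtotal.
    rewrite <- (wsum_lin a b HU b _ _ 1 1).
    - apply wsum_ext; intros j.
      change (peak_orbit a b (S j)) with (T a b (peak_orbit a b j)); unfold T.
      destruct (Rle_dec (peak_orbit a b j) a) as [hl|hl].
      + rewrite Rmin_left by exact hl; field; lra.
      + rewrite Rmin_right by lra; field; lra.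
    - intros j; apply Rabs_unit, peak_orbit_range1, HU.
    - intros j; apply Rabs_unit, peak_orbit_range1, HU. }
  rewrite h; field; lra.
Qed.

End Derivative.

Lemma sojourn_left a b t n y : inU a b -> y <= a ->
  sojourn a b t (S n) y = a / b * sojourn a b t n (T a b y).
Proof.
  intros hU hy; destruct (inU_bounds a b hU) as (ha & ha1 & hb & _); simpl.
  unfold slope, right_ind; destruct (Rle_dec y a); [field; lra | lra].
Qed.

(** The recursion rearranged to match the geometry: [0,a] is mapped onto [0,b], and ]a,y] onto [T y,
    b[. *)
Lemma sojourn_right a b t n y : inU a b -> a < y ->
  sojourn a b t (S n) y
  = a / b * sojourn a b t n b
    + (1 - a) / b * (sojourn a b t n b - sojourn a b t n (T a b y)).
Proof.
  intros hU hy; destruct (inU_bounds a b hU) as (ha & ha1 & hb & _); simpl.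
  unfold slope, right_ind; destruct (Rle_dec y a); [lra | field; lra].
Qed.

(** [F] is constrained only on [0,1]; composing with this retraction yields a distribution function
    on the whole line. *)
Definition clamp01 (x : R) : R := Rmax 0 (Rmin x 1).

Lemma clamp01_range x : 0 <= clamp01 x <= 1.
Proof. unfold clamp01, Rmax, Rmin; destruct (Rle_dec x 1);
  match goal with |- context [Rle_dec 0 ?z] => destruct (Rle_dec 0 z) end; lra. Qed.

Lemma clamp01_id x : 0 <= x <= 1 -> clamp01 x = x.
Proof. intros; unfold clamp01; rewrite Rmin_left, Rmax_right; lra. Qed.

Lemma clamp01_low x : x <= 0 -> clamp01 x = 0.
Proof. intros; unfold clamp01; rewrite Rmin_left, Rmax_left; lra. Qed.

Lemma clamp01_high x : 1 <= x -> clamp01 x = 1.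
Proof. intros; unfold clamp01; rewrite Rmin_right, Rmax_right; lra. Qed.

Lemma clamp01_le x y : x <= y -> 0 <= clamp01 y - clamp01 x <= y - x.
Proof.
  intros; unfold clamp01, Rmax, Rmin.
  destruct (Rle_dec x 1), (Rle_dec y 1);
    repeat match goal with |- context [Rle_dec 0 ?z] => destruct (Rle_dec 0 z) end; lra.
Qed.

Lemma ac_cdf_clamp_le F x y : is_ac_cdf F -> x <= y -> F (clamp01 x) <= F (clamp01 y).
Proof.
  intros (_ & _ & hmono & _) hxy.
  pose proof (clamp01_range x); pose proof (clamp01_range y); pose proof (clamp01_le x y hxy).
  apply hmono; lra.
Qed.

Lemma ac_cdf_clamp_continuity F x eps : is_ac_cdf F -> 0 < eps ->
  exists d, 0 < d /\
    forall y, Rabs (y - x) < d -> Rabs (F (clamp01 y) - F (clamp01 x)) < eps.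
Proof.
  intros (_ & _ & _ & hac) heps.
  destruct (hac eps heps) as (d & hd & h).
  assert (key : forall u v, u <= v -> v - u < d -> Rabs (F (clamp01 v) - F (clamp01 u)) < eps).
  { intros u v huv hlt; pose proof (clamp01_le u v huv).
    pose proof (clamp01_range u); pose proof (clamp01_range v).
    (* Continuity is absolute continuity for a family of one interval. *)
    destruct (h 1%nat (fun _ => clamp01 u) (fun _ => clamp01 v)) as [h0 | h0].
    - intros; lra.
    - intros; lia.
    - right; simpl; lra.
    - discriminate.
    - exact h0. }
  exists d; split; [exact hd|]; intros y hy; apply Rabs_def2 in hy.
  destruct (Rle_dec x y).
  - apply key; lra.
  - rewrite Rabs_minus_sym; apply key; lra.
Qed.

Lemma T_derivable a b y : y <> a -> derivable_pt_lim (T a b) y (slope a b y).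
Proof.
  intros hy; unfold slope; destruct (Rle_dec y a) as [hle|hlt].
  - apply is_derive_Reals; apply is_derive_ext_loc with (fun x => b / a * x).
    + assert (hd : 0 < a - y) by lra.
      exists (mkposreal _ hd); intros z hz; unfold ball in hz; simpl in hz.
      unfold AbsRing_ball, abs, minus, plus, opp in hz; simpl in hz.
      apply Rabs_def2 in hz; unfold T; destruct (Rle_dec z a); [reflexivity | lra].
    + auto_derive; [exact I | ring].
  - apply is_derive_Reals; apply is_derive_ext_loc with (fun x => b / (1 - a) * (1 - x)).
    + assert (hd : 0 < y - a) by lra.
      exists (mkposreal _ hd); intros z hz; unfold ball in hz; simpl in hz.
      unfold AbsRing_ball, abs, minus, plus, opp in hz; simpl in hz.
      apply Rabs_def2 in hz; unfold T; destruct (Rle_dec z a); [lra | reflexivity].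
    + auto_derive; [exact I | ring].
Qed.

(** The chain rule applies because the orbit avoids the corner of T at [a]; uniqueness of
    derivatives then identifies the given [d] with products of slopes. *)
Lemma iterT_derivative_log a b x d : inU a b ->
  (forall n, iterT a b n x <> a) ->
  (forall N, derivable_pt_lim (iterT a b N) x (d N)) ->
  forall N, ln (Rabs (d (S N)))
    = sum_f_R0 (fun n => if Rle_dec (iterT a b n x) a then ln (b / a) else ln (b / (1 - a))) N.
Proof.
  intros hU hne hd.
  destruct (inU_bounds a b hU) as (ha & ha1 & hb & _).
  assert (hS : forall N, d (S N) = slope a b (iterT a b N x) * d N).
  { intros N; apply (uniqueness_limite (iterT a b (S N)) x); [apply hd|].
    apply (derivable_pt_lim_comp (iterT a b N) (T a b)); [apply hd | apply T_derivable, hne]. }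
  assert (h0 : d O = 1).
  { apply (uniqueness_limite (iterT a b 0) x); [apply hd | apply derivable_pt_lim_id]. }
  assert (hlog : forall n, ln (Rabs (slope a b (iterT a b n x)))
    = if Rle_dec (iterT a b n x) a then ln (b / a) else ln (b / (1 - a))).
  { intros n; unfold slope; destruct (Rle_dec (iterT a b n x) a).
    - rewrite Rabs_pos_eq; [reflexivity | left; apply Rdiv_lt_0_compat; lra].
    - rewrite Rabs_Ropp, Rabs_pos_eq; [reflexivity | left; apply Rdiv_lt_0_compat; lra]. }
  assert (hne0 : forall N, d N <> 0).
  { intros N; induction N as [|N IH]; [rewrite h0; lra|].
    rewrite hS; apply Rmult_integral_contrapositive_currified; [apply slope_neq0, hU | exact IH]. }
  intros N; induction N as [|N IH].
  - rewrite hS, h0, Rmult_1_r; apply hlog.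
  - rewrite tech5, <- IH, <- hlog, hS, Rabs_mult, ln_mult; [ring | |];
      apply Rabs_pos_lt; [apply slope_neq0, hU | apply hne0].
Qed.
From HB Require Import structures.
From mathcomp Require Import all_boot all_order all_algebra.
From mathcomp Require Import all_classical all_reals all_analysis.
From mathcomp Require Import measurable_realfun Rstruct.
Import Order.TTheory GRing.Theory Num.Theory numFieldNormedType.Exports.
Local Open Scope classical_set_scope.
Local Open Scope ring_scope.
Set Implicit Arguments. Unset Strict Implicit. Unset Printing Implicit Defensive.

(** * Absolutely continuous measures and weak convergence *)

Section WeakConvergence.
Import HBSimple.
Context {R : realType}.
Local Notation lam := (@lebesgue_measure R).
Local Notation D := (`]0, 1]%classic : set (measurableTypeR R)).
Variables (psi : nat -> measurableTypeR R -> R) (M : R).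
Hypothesis mpsi : forall n, measurable_fun setT (psi n).
Hypothesis psiM : forall n x, `|psi n x| <= M.
Hypothesis psi0 : forall y, 0 <= y <= 1 ->
  (\int[lam]_(x in `]0%R, y]) psi n x) @[n --> \oo] --> (0 : R).

Let weak_null (f : measurableTypeR R -> R) :=
  lam.-integrable D (EFin \o f) /\
  (\int[lam]_(x in D) (psi n x * f x)) @[n --> \oo] --> (0 : R).

Let mD : measurable D. Proof. exact: measurable_itv. Qed.

Let lamD : (lam D < +oo)%E.
Proof. by rewrite lebesgue_measure_itv/= lte_fin ltr01 -EFinB ltry. Qed.

Let M0 : 0 <= M. Proof. exact: le_trans (normr_ge0 _) (psiM 0%N 0). Qed.

Let integrable_psiM n (f : measurableTypeR R -> R) : lam.-integrable D (EFin \o f) ->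
  lam.-integrable D (EFin \o (fun x => psi n x * f x)).
Proof.
move=> fi.
have := @integrableMr _ _ _ lam D mD (psi n) _ _ _ fi; apply.
  exact: measurable_funTS.
exists M; split; first exact: num_real.
by move=> x Mx y _; apply: le_trans (psiM n y) (ltW Mx).
Qed.

Let Rintegral_psiM_le n (f : measurableTypeR R -> R) : lam.-integrable D (EFin \o f) ->
  `|\int[lam]_(x in D) (psi n x * f x)| <= M * \int[lam]_(x in D) `|f x|.
Proof.
move=> fi; have nfi : lam.-integrable D (EFin \o (fun x => `|f x|)).
  exact: (integrable_norm fi).
apply: le_trans (le_normr_Rintegral mD (integrable_psiM n fi)) _.
rewrite -RintegralZl//; apply: le_Rintegral => //.
- exact: (integrable_norm (integrable_psiM n fi)).
- exact: (integrableZl mD M nfi).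
- by move=> x _; rewrite normrM ler_wpM2r.
Qed.

Let weak_null_lin c f h : weak_null f -> weak_null h -> weak_null (fun x => f x + c * h x).
Proof.
move=> [fi fc] [hi hc].
have chi : lam.-integrable D (EFin \o (fun x => c * h x)) := integrableZl mD c hi.
split.
  have := integrableD mD fi chi.
  by apply: eq_integrable => // x _ /=; rewrite EFinD.
rewrite (_ : (fun n => _) = (fun n => \int[lam]_(x in D) (psi n x * f x) +
    c * \int[lam]_(x in D) (psi n x * h x))); last first.
  apply/funext => n; rewrite -RintegralZl//; last exact: integrable_psiM.
  rewrite -RintegralD//.
  - by apply: eq_Rintegral => x _; rewrite mulrDr mulrCA.
  - exact: integrable_psiM.
  - exact: (integrableZl mD c (integrable_psiM n hi)).
rewrite [X in _ --> X](_ : _ = 0 + c * 0); last by rewrite mulr0 addr0.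
by apply: cvgD => //; exact: cvgMl_tmp.
Qed.

(** The bound on [psi] gives |∫ psi_n (f - h)| ≤ M ‖f - h‖_1 uniformly in n. Dividing by M + 1
    avoids the case M = 0. *)
Let weak_null_approx f : lam.-integrable D (EFin \o f) ->
  (forall e, 0 < e -> exists2 h, weak_null h & \int[lam]_(x in D) `|f x - h x| <= e) ->
  weak_null f.
Proof.
move=> fi fapprox; split=> //; apply/cvgr0Pnorm_le => e e0.
have M1 : 0 < M + 1 by rewrite ltr_wpDl.
have [h [hi hc] hle] := fapprox (e / 2 / (M + 1)) (divr_gt0 (divr_gt0 e0 (ltr0n _ 2)) M1).
have e20 : 0 < e / 2 by rewrite divr_gt0.
have fhi : lam.-integrable D (EFin \o (fun x => f x - h x)).
  by have := integrableB mD fi hi; apply: eq_integrable => // x _ /=; rewrite EFinB.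
move/cvgr0Pnorm_le : hc => /(_ _ e20); apply: filterS => n hn.
have -> : \int[lam]_(x in D) (psi n x * f x) =
    \int[lam]_(x in D) (psi n x * h x) + \int[lam]_(x in D) (psi n x * (f x - h x)).
  rewrite -RintegralD//; [|exact: integrable_psiM..].
  by apply: eq_Rintegral => x _; rewrite -mulrDr addrC subrK.
apply: le_trans (ler_normD _ _) _; rewrite [leRHS]splitr lerD//.
apply: le_trans (Rintegral_psiM_le n fhi) _.
apply: le_trans (ler_wpM2l M0 hle) _.
rewrite mulrCA ler_piMr// ?(ltW e20)// ler_pdivrMr// mul1r.
by rewrite lerDl.
Qed.

Let integrable_indicD (B : set (measurableTypeR R)) : measurable B ->
  lam.-integrable D (EFin \o (\1_B : _ -> R)).
Proof.
move=> mB; apply: measurable_bounded_integrable => //.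
exists 1; split; first exact: num_real.
move=> x x1 y _ /=; rewrite indicE; case: (y \in B); rewrite ?normr1 ?normr0 ?ltW//.
exact: lt_trans x1.
Qed.

Let Rintegral_psi_indic n (B : set (measurableTypeR R)) :
  \int[lam]_(x in D) (psi n x * \1_B x) = \int[lam]_(x in D `&` B) psi n x.
Proof.
rewrite Rintegral_mkcondr; apply: eq_Rintegral => x _.
by rewrite patchE indicE; case: (x \in B); rewrite ?mulr1 ?mulr0.
Qed.

Let weak_null_itv y : weak_null (\1_(`]y, +oo[%classic)).
Proof.
split; first exact: integrable_indicD.
have psiD n : lam.-integrable D (EFin \o psi n).
  apply: measurable_bounded_integrable => //; first exact: measurable_funTS.
  exists M; split; first exact: num_real.
  by move=> x Mx z _; apply: le_trans (psiM n z) (ltW Mx).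
have [y0|y0] := leP y 0.
  rewrite (_ : (fun n => _) = (fun n => \int[lam]_(x in `]0%R, 1%R]) psi n x)).
    by apply: psi0; rewrite ler01 lexx.
  apply/funext => n; rewrite Rintegral_psi_indic; congr (Rintegral _ _ _).
  apply/seteqP; split=> [x [] //|x Dx]; split=> //.
  by move: Dx; rewrite /= !in_itv/= andbT => /andP[x0 _]; exact: le_lt_trans x0.
have [y1|y1] := leP 1 y.
  rewrite (_ : (fun n => _) = cst 0); first exact: cvg_cst.
  apply/funext => n; rewrite Rintegral_psi_indic (_ : _ `&` _ = set0) ?Rintegral_set0//.
  apply/seteqP; split=> x //= []; rewrite !in_itv/= andbT => /andP[_ x1] yx.
  by move: (lt_le_trans (le_lt_trans y1 yx) x1); rewrite ltxx.
rewrite (_ : (fun n => _) = (fun n => \int[lam]_(x in `]0%R, 1%R]) psi n x -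
    \int[lam]_(x in `]0%R, y]) psi n x)).
  rewrite [X in _ --> X](_ : _ = 0 - 0); last by rewrite subr0.
  by apply: cvgB; apply: psi0; rewrite ?ler01 ?lexx// !ltW.
apply/funext => n; rewrite Rintegral_psi_indic Rintegral_itvB ?bnd_simp ?(ltW y0) ?(ltW y1)//.
congr (Rintegral _ _ _); apply/seteqP; split=> x /=; rewrite !in_itv/= andbT.
  by move=> [/andP[_ ->] ->].
by move=> /andP[yx ->]; rewrite yx (lt_trans y0 yx).
Qed.

Let weak_null0 : weak_null (cst 0).
Proof.
split; first by have := @integrable0 _ _ _ lam D; apply: eq_integrable.
rewrite (_ : (fun n => _) = cst 0); first exact: cvg_cst.
by apply/funext => n; under eq_Rintegral do rewrite mulr0; rewrite Rintegral_cst// mul0r.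
Qed.

Let weak_null_ext f h : f =1 h -> weak_null f -> weak_null h.
Proof. by move=> /funext ->. Qed.

(** Dynkin's π-λ argument: the rays form a π-system, complements follow by linearity, and a
    countable disjoint union is an L^1 limit of its partial unions on [D]. *)
Let weak_null_indic (B : set (measurableTypeR R)) : measurable B -> weak_null (\1_B).
Proof.
move=> mB; move: (mB); rewrite {1}(RGenOInfty.measurableE R).
have weakT : weak_null (\1_[set: measurableTypeR R]).
  have [_ cvg0] := weak_null_itv 0; split; first exact: integrable_indicD.
  move: cvg0; rewrite (_ : (fun n => _) =
    (fun n => \int[lam]_(x in D) (psi n x * \1_(setT : set (measurableTypeR R)) x)))//.
  apply/funext => n; apply: eq_Rintegral => x xD; rewrite indicT indicE mem_set//=.
  by move: xD; rewrite inE/= !in_itv/= andbT => /andP[].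
apply: (@dynkin_induction _ (measurableTypeR R) (@RGenOInfty.G R)
    (fun B => weak_null (\1_B))) => //.
- exact: RGenOInfty.measurableE.
- move=> _ _ [x ->] [y ->]; exists (Num.max x y).
  apply/seteqP; split=> z /=; rewrite !in_itv/= !andbT gt_max.
    by move=> [-> ->].
  by move=> /andP[].
- by move=> _ [y ->]; exact: weak_null_itv.
- move=> S mS wS; apply: weak_null_ext (weak_null_lin (-1) weakT wS) => x.
  by rewrite indicT !indicE in_setC mulN1r; case: (x \in S); rewrite /= ?subrr ?subr0.
- move=> F mF tF wF; apply: weak_null_approx.
    by apply: integrable_indicD; exact: bigcup_measurable.
  move=> e e0.
  pose U n := \big[setU/set0]_(k < n.+1) F k.
  have mU n : measurable (U n) by exact: bigsetU_measurable.
  have wU n : weak_null (\1_(U n)).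
    rewrite /U; elim: n.+1 => {n}[|n IH].
      by rewrite big_ord0 indic0; exact: weak_null0.
    rewrite big_ord_recr/=; apply: weak_null_ext (weak_null_lin 1 IH (wF n)) => x.
    rewrite mul1r !indicE in_setU.
    case: (boolP (x \in F n)) => xFn; last by rewrite orbF addr0.
    case: (boolP (x \in \big[setU/set0]_(k < n) F k)) => [|_]; last by rewrite add0r.
    rewrite !inE in xFn *; rewrite -bigcup_mkord => -[k /= kn xFk].
    by move: kn; rewrite (tF k n I I (ex_intro _ x (conj xFk xFn))) ltnn.
  have mUoo : measurable (\bigcup_k F k) by exact: bigcup_measurable.
  have cvgU : lam (D `&` U n) @[n --> \oo] --> lam (\bigcup_n (D `&` U n)).
    apply: nondecreasing_cvg_mu.
    + by move=> n; exact: measurableI.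
    + by apply: bigcupT_measurable => n; exact: measurableI.
    + by move=> n m nm; apply/subsetPset; apply: setIS; exact: (@subset_bigsetU _ F n.+1 m.+1).
  have UE : \bigcup_n (D `&` U n) = D `&` \bigcup_k F k.
    by rewrite -setI_bigcupr /U bigcup_bigsetU_bigcup.
  have finI (A : set (measurableTypeR R)) : measurable A -> lam (D `&` A) \is a fin_num.
    move=> mA; rewrite ge0_fin_numE// (le_lt_trans _ lamD)// le_measure// ?inE//.
    exact: measurableI.
  have : fine (lam (D `&` U n)) @[n --> \oo] --> fine (lam (D `&` \bigcup_k F k)).
    by apply: fine_cvg; rewrite fineK ?finI// -UE.
  move=> /cvgrPdist_le /(_ _ e0) [N _ /(_ N (leqnn N)) hN].
  exists (\1_(U N)) => //; apply: le_trans hN.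
  have sub : U N `<=` \bigcup_k F k by rewrite /U -bigcup_mkord => x [k _ Fkx]; exists k.
  rewrite (_ : fine _ - fine _ = \int[lam]_(x in D) (\1_(\bigcup_k F k) x - \1_(U N) x)).
    rewrite (@eq_Rintegral _ _ _ _ _ (fun x => \1_(\bigcup_k F k) x - \1_(U N) x)).
      exact: ler_norm.
    move=> x _ /=; rewrite ger0_norm// subr_ge0 !indicE.
    case: (boolP (x \in U N)) => [xU|_]; last by rewrite ler0n.
    by rewrite (_ : x \in _ = true)// mem_set//; apply: sub; rewrite inE in xU.
  by rewrite RintegralB ?integrable_indicD// /Rintegral !integral_indic// setIC [U N `&` _]setIC.
Qed.

Lemma weak_null_integrable f : lam.-integrable D (EFin \o f) ->
  (\int[lam]_(x in D) (psi n x * f x)) @[n --> \oo] --> (0 : R).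
Proof.
move=> fi; suff [] : weak_null f by [].
apply: weak_null_approx => // e e0.
have [s_ [si _ sc]] := approximation_sfun_integrable mD fi.
have /cvgrPdist_le := @fine_cvg _ _ _ eventually_filter _ _ sc; move=> /(_ _ e0) [N _ /(_ N (leqnn N)) hN].
exists (s_ N).
  have -> : s_ N = (fun x => \sum_(y \in range (s_ N)) y * \1_(s_ N @^-1` [set y]) x) :> (_ -> _).
    by apply/funext => x; rewrite {1}fimfunE.
  rewrite (_ : (fun x => _) = (fun x => \sum_(y <- finmap.enum_fset (fset_set (range (s_ N))))
      y * \1_(s_ N @^-1` [set y]) x)); last first.
    by apply/funext => x; rewrite fsbig_finite.
  elim: (finmap.enum_fset _) => [|y r IH].
    by apply: weak_null_ext weak_null0 => x; rewrite big_nil.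
  apply: (weak_null_ext _ (weak_null_lin y IH (weak_null_indic _))) => [x|].
    by rewrite big_cons addrC.
  by rewrite -[X in measurable X]setTI; exact: measurable_funP.
by move: hN; rewrite sub0r normrN => /(le_trans (ler_norm _)); rewrite /Rintegral.
Qed.

End WeakConvergence.

Section AbsoluteContinuity.
Context {R : realType}.
Local Notation lam := (@lebesgue_measure R).
Local Notation D := (`]0, 1]%classic : set (measurableTypeR R)).

(** Outer regularity puts a null set inside an open [U] of Lebesgue measure below [d]. The ordered
    finite families required by the hypothesis are the cells of the partition into steps 1 / (m + 1)
    that lie in [U]. *)
Lemma abs_cont_null_dominates (mu : {finite_measure set (measurableTypeR R) -> \bar R}) :
  mu (~` D) = 0%E ->
  (forall e, 0 < e -> exists2 d, 0 < d & forall n (l r : nat -> R),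
     (forall i, (i < n)%N -> 0 <= l i /\ l i <= r i /\ r i <= 1) ->
     (forall i, (i.+1 < n)%N -> r i <= l i.+1) ->
     \sum_(i < n) (r i - l i) < d ->
     (\sum_(i < n) mu `]l i, r i]%classic <= e%:E)%E) ->
  mu `<< lam.
Proof.
move=> muD muac; apply/null_content_dominatesP => A mA lA0.
have mD : measurable D by exact: measurable_itv.
suff muAD : mu (A `&` D) = 0%E.
  have -> : A = (A `&` D) `|` (A `&` ~` D) by rewrite -setIUr setUCr setIT.
  apply/eqP; rewrite eq_le measure_ge0 andbT.
  have mAC : measurable (A `&` ~` D) by apply: measurableI => //; exact: measurableC.
  apply: le_trans (measureU2 mu (measurableI _ _ mA mD) mAC) _.
  rewrite [X in (X + _ <= _)%E]muAD add0e -[leRHS]muD.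
  by apply: le_measure; rewrite ?inE//; exact: measurableC.
apply/eqP; rewrite eq_le measure_ge0 andbT; apply/lee_addgt0Pr => e e0.
rewrite add0e; have [d d0 hd] := muac e e0.
have [U [oU AU UAd]] : exists U : set R, [/\ open U, A `<=` U & (lam (U `\` A) < d%:E)%E].
  by apply: lebesgue_regularity_outer => //; rewrite lA0 ltry.
have mU : measurable (U : set (measurableTypeR R)) by exact: open_measurable.
have lU : (lam U < d%:E)%E.
  apply: le_lt_trans UAd.
  rewrite -[X in (lam X <= _)%E](setDUK AU).
  apply: le_trans (measureU2 lam mA (measurableD mU mA)) _.
  by rewrite [X in (X + _ <= _)%E]lA0 add0e.
pose N m : R := m.+1%:R.
have N0 m : 0 < N m by rewrite ltr0n.
pose sel m i := asbool (`]i%:R / N m, i.+1%:R / N m]%classic `<=` U).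
pose l m i : R := i%:R / N m.
(* An unselected cell is collapsed to an empty interval, so the family keeps its order and its m + 1
   members. *)
pose r m i : R := if sel m i then i.+1%:R / N m else i%:R / N m.
have lr m i : l m i <= r m i.
  by rewrite /l /r; case: ifP => // _; rewrite ler_pM2r ?invr_gt0// ler_nat.
have rl m i : r m i <= l m i.+1.
  by rewrite /l /r; case: ifP => // _; rewrite ler_pM2r ?invr_gt0// ler_nat.
have l_le m i j : (i <= j)%N -> l m i <= l m j.
  by move=> ij; rewrite /l ler_pM2r ?invr_gt0// ler_nat.
pose J m i : set (measurableTypeR R) := `]l m i, r m i]%classic.
have mJ m i : measurable (J m i) by exact: measurable_itv.
have JU m i : J m i `<=` U.
  rewrite /J /l /r; case: ifP => [/asboolP//|_].
  by rewrite set_itv_ge// bnd_simp ltxx.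
pose V m := \big[setU/set0]_(i < m.+1) J m i.
have mV m : measurable (V m) by exact: bigsetU_measurable.
have VU m : V m `<=` U by move=> x; rewrite /V -bigcup_mkord => -[i _]; exact: JU.
have tJ m : trivIset setT (J m).
  apply/trivIsetP => i j _ _; wlog ij : i j / (i < j)%N.
    move=> h nij; case: (ltngtP i j) => [ij|ji|ij]; first exact: h.
      by rewrite setIC; apply: h => //; rewrite eq_sym.
    by rewrite ij eqxx in nij.
  move=> _; apply/seteqP; split=> x //=; rewrite /J /= !in_itv/= => -[/andP[_ xi] /andP[jx _]].
  have := lt_le_trans jx (le_trans xi (le_trans (rl m i) (l_le m _ _ ij))).
  by rewrite ltxx.
have muV m : (mu (V m) <= e%:E)%E.
  apply: le_trans (@Boole_inequality _ _ _ mu (J m) m.+1 (fun i _ => mJ m i)) _.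
  apply: hd.
  - move=> i im; split; first by rewrite /l divr_ge0// ltW.
    split; first exact: lr.
    apply: le_trans (rl m i) _; rewrite /l ler_pdivrMr// mul1r ler_nat; exact: im.
  - by move=> i _; exact: rl.
  - rewrite -lte_fin; apply: le_lt_trans lU.
    rewrite (_ : (_)%:E = lam (V m)).
      by apply: le_measure => //; rewrite inE.
    rewrite /V measure_bigsetU//= -sumEFin; apply: eq_bigr => i _.
    rewrite /J lebesgue_measure_itv/= lte_fin -EFinB.
    by have := lr m i; rewrite le_eqVlt => /predU1P[->|->//]; rewrite ltxx subrr.
(* The cells of the uniform partitions contained in [U] exhaust it; passing to [W] makes this
   exhaustion monotone. *)
pose W k := \bigcap_(m in [set m | (k <= m)%N]) V m.
have mW k : measurable (W k).
  by apply: bigcap_measurable => //; exists k => /=.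
have muW : mu (W k) @[k --> \oo] --> mu (\bigcup_k W k).
  apply: nondecreasing_cvg_mu => //; first exact: bigcupT_measurable.
  move=> k k' kk'; apply/subsetPset => x Wx m /= km.
  by apply: Wx => /=; exact: leq_trans km.
have muWe : (mu (\bigcup_k W k) <= e%:E)%E.
  rewrite -(cvg_lim _ muW)//; apply: lime_le; first by apply/cvg_ex; eexists; exact: muW.
  apply: nearW => k; apply: le_trans (muV k); apply: le_measure; rewrite ?inE//.
  by move=> x; apply; exact: leqnn.
apply: le_trans muWe; apply: le_measure; rewrite ?inE//.
- exact: measurableI.
- exact: bigcupT_measurable.
move=> x [/AU Ux]; rewrite /= in_itv/= => /andP[x0 x1].
have [eps /= eps0 xeps] : nbhs x U by exact: open_nbhs_nbhs.
have [k _ hk] : \forall k \near \oo, k.+1%:R^-1 < eps by exact: (near_infty_natSinv_lt (PosNum eps0)).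
exists k => // m /= km; have {}hk : (N m)^-1 < eps by exact: hk.
have exi : exists i, x <= i.+1%:R / N m.
  by exists m; rewrite divff// gt_eqF.
(* The least such [i] is the cell containing [x]; its mesh is below the radius [eps] of a ball
   inside [U], so the cell is selected. *)
case: (ex_minnP exi) => i xi imin.
have li : l m i < x.
  rewrite ltNge; apply/negP => xl; case: i xi imin xl => [|i] xi imin xl.
    by move: xl; rewrite /l mul0r leNgt x0.
  by have := imin i xl; rewrite ltnn.
have seli : sel m i.
  apply/asboolP => y /=; rewrite in_itv/= => /andP[iy yi]; apply: xeps => /=.
  apply: le_lt_trans hk; rewrite ler_norml; apply/andP; split.
    rewrite lerBrDl -lerBrDr opprK; apply: le_trans yi _.
    rewrite -[in leLHS]natr1 mulrDl mul1r lerD2r; exact: ltW.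
  rewrite lerBlDr; apply: le_trans xi _.
  by rewrite -[in leLHS]natr1 mulrDl mul1r addrC lerD2l; exact: ltW.
rewrite /V -bigcup_mkord; exists i => /=.
  by rewrite ltnS; apply: imin; rewrite divff// gt_eqF.
by rewrite /J /r seli /= in_itv/= li.
Qed.

Lemma weak_null_abs_cont (mu : probability (measurableTypeR R) R)
    (psi : nat -> measurableTypeR R -> R) (M : R) :
  mu `<< lam ->
  (forall n, measurable_fun setT (psi n)) ->
  (forall n x, `|psi n x| <= M) ->
  (forall y, 0 <= y <= 1 ->
    (\int[lam]_(x in `]0%R, y]) psi n x) @[n --> \oo] --> (0 : R)) ->
  (\int[mu]_(x in D) psi n x) @[n --> \oo] --> (0 : R).
Proof.
move=> mulam mpsi psiM psi0.
pose rn := Radon_Nikodym (charge_of_finite_measure mu) lam.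
have rnfin x : rn x \is a fin_num by exact: Radon_Nikodym_fin_num.
have rnE : EFin \o (fine \o rn) = rn by apply/funext => x /=; rewrite fineK.
have mD : measurable D by exact: measurable_itv.
have rni : lam.-integrable D (EFin \o (fine \o rn)).
  by rewrite rnE; apply: (integrableS measurableT) => //; exact: Radon_Nikodym_integrable.
rewrite (_ : (fun n => _) = (fun n => \int[lam]_(x in D) (psi n x * (fine \o rn) x))).
  exact: (@weak_null_integrable R psi M mpsi psiM psi0 (fine \o rn) rni).
apply/funext => n; rewrite /Rintegral; congr fine.
rewrite -(Radon_Nikodym_change_of_variables mulam mD).
  by apply: eq_integral => x _; rewrite EFinM /= (fineK (rnfin x)).
apply: measurable_bounded_integrable => //.
- by rewrite (le_lt_trans (probability_le1 _ _))// ltry.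
- exact: measurable_funTS.
- exists M; split; first exact: num_real.
  by move=> x Mx y _; apply: le_trans (psiM n y) (ltW Mx).
Qed.

End AbsoluteContinuity.

Lemma pushforward_is_measure d d' (T1 : measurableType d) (T2 : measurableType d')
    (R : realType) (m : {measure set T1 -> \bar R}) (f : T1 -> T2) :
  measurable_fun [set: T1] f ->
  exists nu : {measure set T2 -> \bar R}, forall B, nu B = m (f @^-1` B).
Proof.
by move=> mf; exists (measure_function_pushforward__canonical__measure_function_Measure m mf).
Qed.

Section AffinePullback.
Context {R : realType}.
Local Notation lam := (@lebesgue_measure R).

(** By uniqueness of Lebesgue measure: |c| times the pushforward gives every ]u,v] its length. For c
    < 0 the preimage is closed on the left and open on the right, hence the other interval shape. *)
Lemma lebesgue_affine (c d : R) (A : set (measurableTypeR R)) : c != 0 -> measurable A ->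
  lam ((fun x => c * x + d) @^-1` A) = ((`|c|^-1)%:E * lam A)%E.
Proof.
move=> c0 mA.
have mf : measurable_fun setT (fun x : measurableTypeR R => c * x + d : measurableTypeR R).
  by apply: measurable_funD => //; exact: measurable_funM.
have [nu nuE] := pushforward_is_measure lam mf.
have absc : 0 < `|c| by rewrite normr_gt0.
pose m : {measure set (measurableTypeR R) -> \bar R} := mscale (NngNum (ltW absc)) nu.
have lamm : lam A = m A.
  refine (@lebesgue_measure_unique R m _ A mA) => _ [[u v] _ <-] /=.
  rewrite /m /mscale nuE/= lebesgue_measure_itv/= lte_fin.
  have [cpos|cneg] := ltP 0 c.
    rewrite (_ : _ @^-1` _ = `](u - d) / c, (v - d) / c]%classic); last first.
      apply/seteqP; split=> x /=; rewrite !in_itv/= ltr_pdivrMr// ler_pdivlMr//;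
      by rewrite ltrBlDr lerBrDr [c * x]mulrC.
    rewrite lebesgue_measure_itv/= lte_fin ltr_pM2r ?invr_gt0// ltrD2r.
    case: ifP => _; last by rewrite mule0.
    rewrite -!EFinB -EFinM -mulrBl opprB addrA subrK gtr0_norm// mulrC divfK//.
  have {}cneg : c < 0 by rewrite lt_neqAle c0.
  rewrite (_ : _ @^-1` _ = [set` Interval (BLeft ((v - d) / c)) (BLeft ((u - d) / c))]); last first.
    apply/seteqP; split=> x /=; rewrite !in_itv/= ltr_ndivlMr// ler_ndivrMr//;
    by rewrite ltrBlDr lerBrDr [c * x]mulrC andbC.
  rewrite lebesgue_measure_itv/= lte_fin ltr_nM2r ?invr_lt0// ltrD2r.
  case: ifP => _; last by rewrite mule0.
  rewrite -!EFinB -EFinM -mulrBl opprB addrA subrK ltr0_norm// mulrC mulrN divfK//.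
  by rewrite opprB.
rewrite lamm; have -> : m A = (`|c|%:E * lam ((fun x => c * x + d)%R @^-1` A))%E by rewrite -nuE.
by rewrite muleA -EFinM mulVf ?gt_eqF// mul1e.
Qed.

Lemma lebesgue_setD1 (A : set (measurableTypeR R)) (x : R) : measurable A ->
  lam (A `\ x) = lam A.
Proof.
move=> mA; rewrite [RHS](measureDI lam mA (measurable_set1 x)).
rewrite [X in (_ + X)%E](_ : _ = 0%E) ?adde0//.
apply/eqP; rewrite eq_le measure_ge0 andbT -(lebesgue_measure_set1 x).
by apply: le_measure; rewrite ?inE//; exact: measurableI.
Qed.

Lemma measurable_piecewise_affine (a c d : R) : measurable_fun setT
  (fun x : measurableTypeR R => (if x <= a then c * x else d * (1 - x)) : measurableTypeR R).
Proof.
apply: measurable_fun_ifT.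
- exact: measurable_fun_ler.
- exact: measurable_funM.
- by apply: measurable_funM => //; exact: measurable_funB.
Qed.

End AffinePullback.

Section StieltjesProbability.
Context {R : realType}.
Variable G : R -> R.
Hypothesis Gnd : forall x y, x <= y -> G x <= G y.
Hypothesis Gcont : forall x e, 0 < e ->
  exists2 d, 0 < d & forall y, `|y - x| < d -> `|G y - G x| < e.
Hypothesis Glow : forall x, x <= 0 -> G x = 0.
Hypothesis Ghigh : forall x, 1 <= x -> G x = 1.

Let G_nd : nondecreasing G. Proof. by move=> x y; exact: Gnd. Qed.

Let G_rc : right_continuous G.
Proof.
apply: right_continuousW => x; apply/(@cvgrPdist_lt _ R^o) => e e0.
have [d d0 hd] := Gcont x e0; exists d => //= y xy; rewrite distrC; apply: hd.
by rewrite distrC.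
Qed.

#[local] HB.instance Definition _ := isCumulative.Build R _ R G G_nd G_rc.

Let G_Ny0 : G @ -oo --> (0 : R).
Proof.
apply: cvg_near_cst; exists 0; split; first exact: num_real.
by move=> x /ltW; exact: Glow.
Qed.

Let G_y1 : G @ +oo --> (1 : R).
Proof.
apply: cvg_near_cst; exists 1; split; first exact: num_real.
by move=> x /ltW; exact: Ghigh.
Qed.

#[local] HB.instance Definition _ := isCumulativeBounded.Build R 0 1 G G_Ny0 G_y1.

(** The uniqueness clause later extends invariance from intervals to all Borel sets. *)
Lemma stieltjes_probability : exists mu : probability (measurableTypeR R) R,
  (forall u v, u <= v -> mu `]u, v]%classic = (G v - G u)%:E) /\
  (forall nu : {measure set (measurableTypeR R) -> \bar R},
     (forall u v, u <= v -> nu `]u, v]%classic = (G v - G u)%:E) ->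
     forall A, measurable A -> nu A = mu A).
Proof.
have mu_oc u v : u <= v -> lebesgue_stieltjes_measure G `]u, v]%classic = (G v - G u)%:E.
  move=> uv; rewrite /lebesgue_stieltjes_measure /measure_extension.
  by rewrite measurable_mu_extE/= ?wlength_itv_bnd//; exact: is_ocitv.
exists (lebesgue_stieltjes_measure G : probability (measurableTypeR R) R); split=> //.
move=> nu nuG A mA; apply/esym.
refine (@lebesgue_stieltjes_measure_unique R G nu _ A mA) => _ [[u v] _ <-] /=.
have [uv|vu] := leP u v; first by rewrite mu_oc// nuG.
by rewrite set_itv_ge ?measure0// bnd_simp -leNgt ltW.
Qed.

End StieltjesProbability.

Section ConstantIntegrals.
Context {R : realType}.
Local Notation lam := (@lebesgue_measure R).
Local Notation D := (`]0, 1]%classic : set (measurableTypeR R)).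
Variables (mu : probability (measurableTypeR R) R) (psi : nat -> measurableTypeR R -> R).
Variables (M c : R).
Hypothesis mpsi : forall n, measurable_fun setT (psi n).
Hypothesis psiM : forall n x, `|psi n x| <= M.
Hypothesis psic : forall n, \int[mu]_(x in D) psi n x = c.

(** The integrals against [mu] tend to 0 through its density, yet are constantly [c]. *)
Lemma weak_null_const : mu `<< lam ->
  (forall y, 0 <= y <= 1 -> forall e, 0 < e -> exists N, forall n, (N <= n)%N ->
    `|\int[lam]_(x in `]0%R, y]) psi n x| <= e) ->
  c = 0.
Proof.
move=> mulam psi0.
have : (\int[mu]_(x in D) psi n x) @[n --> \oo] --> (0 : R).
  apply: (weak_null_abs_cont mulam mpsi psiM) => y y01.
  apply/cvgr0Pnorm_le => e e0; have [N hN] := psi0 y y01 e e0.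
  by exists N => // n /= Nn; exact: hN.
rewrite (_ : (fun n => _) = cst c); last by apply/funext => n; exact: psic.
by move=> c0; exact: cvg_unique (@cvg_cst _ _ _ _ _) c0.
Qed.

(** The same conclusion from pointwise convergence off a negligible set, by dominated convergence
    with the constant bound [M]. *)
Lemma ae_null_const (bad : set (measurableTypeR R)) : mu.-negligible bad ->
  (forall x, D x -> ~ bad x -> forall e, 0 < e -> exists N, forall n, (N <= n)%N ->
    `|psi n x| <= e) ->
  c = 0.
Proof.
move=> badN psi0.
have mD : measurable D by exact: measurable_itv.
have psii n : mu.-integrable D (EFin \o psi n).
  apply: measurable_bounded_integrable => //.
  - by rewrite (le_lt_trans (probability_le1 _ _))// ltry.
  - exact: measurable_funTS.
  - exists M; split; first exact: num_real.
    by move=> x Mx y _; apply: le_trans (psiM n y) (ltW Mx).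
have [] := @dominated_convergence _ (measurableTypeR R) R mu D mD
  (fun n x => (psi n x)%:E) (cst 0%E) (cst M%:E).
- by move=> n; apply: measurable_funTS; apply/measurable_EFinP.
- exact: measurable_cst.
- apply: negligibleS badN => x /= h; apply: contrapT => nbad; apply: h => Dx.
  apply/cvg_EFin; first exact: nearW.
  apply/cvgr0Pnorm_le => e e0; have [N hN] := psi0 x Dx nbad e e0.
  by exists N => // n /= Nn; exact: hN.
- exact: finite_measure_integrable_cst.
- by apply: aeW => x n _; rewrite lee_fin.
move=> _ _; rewrite integral0 (_ : [sequence _]_n = cst c%:E).
  by move=> c0; apply: EFin_inj; exact: cvg_unique (@cvg_cst _ _ _ _ _) c0.
apply/funext => n /=; rewrite -(psic n) /Rintegral fineK//.
exact: (integrable_fin_num mD (psii n)).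
Qed.

End ConstantIntegrals.

Section MeanIndicator.
Context {R : realType}.
Variable A : nat -> set (measurableTypeR R).
Hypothesis mA : forall n, measurable (A n).

(** A visit frequency scaled by [s] and centred by [g]. Two cases occur: s = 1 with [g] the limiting
    frequency, and s = p - q, g = Lam - q with p, q the logarithms of the two slopes, since p f + q
    (1 - f) - Lam = (p - q) f - (Lam - q). *)
Definition mean_indic (s g : R) (N : nat) (x : measurableTypeR R) : R :=
  (\sum_(n < N.+1) \1_(A n) x) * (s / N.+1%:R) - g.

Let msum N : measurable_fun setT (fun x : measurableTypeR R => \sum_(n < N) (\1_(A n) x : R)).
Proof.
elim: N => [|N IH]; first by under eq_fun do rewrite big_ord0; exact: measurable_cst.
under eq_fun do rewrite big_ord_recr/=.
by apply: measurable_funD => //; exact: measurable_indic.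
Qed.

Let sum_ge0 N x : 0 <= \sum_(n < N) (\1_(A n) x : R).
Proof. by apply: sumr_ge0 => n _; rewrite indicE. Qed.

Let sum_le N x : \sum_(n < N) (\1_(A n) x : R) <= N%:R.
Proof.
elim: N => [|N IH]; first by rewrite big_ord0.
by rewrite big_ord_recr/= -natr1 lerD// indicE; case: (x \in A N).
Qed.

Lemma measurable_mean_indic s g N : measurable_fun setT (mean_indic s g N).
Proof. by apply: measurable_funB => //; apply: measurable_funM => //; exact: msum. Qed.

Lemma mean_indic_le s g N x : `|mean_indic s g N x| <= `|s| + `|g|.
Proof.
rewrite (le_trans (ler_normB _ _))// lerD2r normrM normf_div (ger0_norm (sum_ge0 _ _)).
rewrite mulrCA ler_piMr// normr_nat ler_pdivrMr ?ltr0n// mul1r; exact: sum_le.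
Qed.

Lemma Rintegral_mean_indic (mu : {measure set (measurableTypeR R) -> \bar R}) E s g N :
  measurable E -> (mu E < +oo)%E ->
  \int[mu]_(x in E) mean_indic s g N x =
  (\sum_(n < N.+1) fine (mu (E `&` A n))) * (s / N.+1%:R) - g * fine (mu E).
Proof.
move=> mE muE.
have indici n : mu.-integrable E (EFin \o (\1_(A n) : _ -> R)).
  apply: measurable_bounded_integrable => //; exists 1; split; first exact: num_real.
  move=> x x1 y _ /=; rewrite indicE.
  by case: (y \in A n); rewrite ?normr1 ?normr0 ltW// (lt_trans _ x1).
have sumi m : mu.-integrable E (EFin \o (fun x => \sum_(n < m) (\1_(A n) x : R))).
  apply: measurable_bounded_integrable => //; first exact: measurable_funTS.
  exists m%:R; split; first exact: num_real.
  by move=> x mx y _ /=; apply: le_trans (ltW mx); rewrite ger0_norm; [exact: sum_le|exact: sum_ge0].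
have sumE m : \int[mu]_(x in E) (\sum_(n < m) (\1_(A n) x : R)) =
    \sum_(n < m) fine (mu (E `&` A n)).
  elim: m => [|m IH].
    rewrite big_ord0; under eq_Rintegral do rewrite big_ord0.
    by rewrite Rintegral_cst// mul0r.
  rewrite big_ord_recr/= -IH.
  have -> : \int[mu]_(x in E) (\sum_(n < m.+1) (\1_(A n) x : R)) =
      \int[mu]_(x in E) (\sum_(n < m) (\1_(A n) x : R) + \1_(A m) x).
    by apply: eq_Rintegral => x _; rewrite big_ord_recr.
  by rewrite RintegralD// /Rintegral integral_indic// setIC.
have csti : mu.-integrable E (EFin \o cst g).
  apply: measurable_bounded_integrable => //; exact: bounded_cst.
rewrite /mean_indic RintegralB//.
  by rewrite RintegralZr// sumE Rintegral_cst.
exact: (integrableZr mE _ (sumi _)).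
Qed.

End MeanIndicator.

(** * The tent map as a measurable transformation *)

Section TentMeasure.
Local Notation RR := Rdefinitions.R.
Local Notation lam := (@lebesgue_measure RR).
Local Notation borel := (measurableTypeR RR).
Local Notation D := (`]0, 1]%classic : set borel).
Variables (a b : RR).
Hypothesis HU : inU a b.

Let a0 : 0 < a. Proof. by apply/RltP; have [] := inU_bounds _ _ HU. Qed.
Let a1 : a < 1. Proof. by apply/RltP; have [? []] := inU_bounds _ _ HU. Qed.
Let b0 : 0 < b. Proof. by apply/RltP; have [? [? []]] := inU_bounds _ _ HU. Qed.
Let b1 : b <= 1. Proof. by apply/RleP; have [? [? [? []]]] := inU_bounds _ _ HU. Qed.
Let ba0 : 0 < b / a. Proof. exact: divr_gt0. Qed.
Let ca0 : 0 < 1 - a. Proof. by rewrite subr_gt0. Qed.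
Let bca0 : 0 < b / (1 - a). Proof. exact: divr_gt0. Qed.

Lemma TE (x : RR) : T a b x = if x <= a then b / a * x else b / (1 - a) * (1 - x).
Proof. by rewrite /T; case: Rle_dec => [/RleP ->//|/RleP/negbTE ->]. Qed.

Lemma T_left (x : RR) : x <= a -> T a b x = b / a * x.
Proof. by rewrite TE => ->. Qed.

Lemma T_right (x : RR) : a <= x -> T a b x = b / (1 - a) * (1 - x).
Proof.
rewrite TE => ax; case: ifPn => // xa.
have -> : x = a by apply/le_anti; rewrite xa ax.
by rewrite divfK ?gt_eqF// divfK ?gt_eqF.
Qed.

Lemma measurable_T : measurable_fun setT (T a b : borel -> borel).
Proof.
rewrite (_ : T a b = fun x => if x <= a then b / a * x else b / (1 - a) * (1 - x)).
  exact: measurable_piecewise_affine.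
by apply/funext => x; exact: TE.
Qed.

Lemma measurable_iterT n : measurable_fun setT (iterT a b n : borel -> borel).
Proof.
elim: n => [|n IH]; first exact: measurable_id.
exact: (measurableT_comp measurable_T IH).
Qed.

Let below n (t : RR) : set borel := [set x | iterT a b n x <= t].

Lemma measurable_below n t : measurable (below n t).
Proof.
rewrite (_ : below n t = iterT a b n @^-1` `]-oo, t]%classic).
  by rewrite -[X in measurable X]setTI; apply: measurable_iterT.
by apply/seteqP; split=> x; rewrite /= in_itv.
Qed.

Lemma lebesgue_T_left (B : set borel) (y : RR) : measurable B -> 0 <= y -> y <= a ->
  lam (`]0%R, y] `&` T a b @^-1` B) = ((a / b)%:E * lam (`]0%R, T a b y] `&` B))%E.
Proof.
move=> mB y0 ya; have c0 : b / a != 0 by rewrite gt_eqF.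
rewrite (_ : _ `&` _ = (fun x => b / a * x + 0) @^-1` (`]0, T a b y]%classic `&` B)).
  rewrite lebesgue_affine//; last exact: measurableI.
  by rewrite gtr0_norm// invf_div.
apply/seteqP; split=> x /=; rewrite !in_itv/= addr0 (T_left ya).
  move=> [/andP[x0 xy]]; rewrite (T_left (le_trans xy ya)) => Bx; split=> //.
  by rewrite mulr_gt0//= ler_pM2l.
rewrite pmulr_rgt0// ler_pM2l// => -[/andP[x0 xy] Bx].
by rewrite x0 xy (T_left (le_trans xy ya)).
Qed.

(** The decreasing branch exchanges the open and closed ends of the interval; [lebesgue_setD1]
    removes one endpoint on each side to restore the left-open form. *)
Lemma lebesgue_T_right (B : set borel) (y : RR) : measurable B -> a <= y -> y <= 1 ->
  lam (`]a, y] `&` T a b @^-1` B) = (((1 - a) / b)%:E * lam (`]T a b y, b] `&` B))%E.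
Proof.
move=> mB ay y1; have c0 : - (b / (1 - a)) != 0 by rewrite oppr_eq0 gt_eqF.
have affE x : - (b / (1 - a)) * x + b / (1 - a) = b / (1 - a) * (1 - x).
  by rewrite mulrBr mulr1 addrC mulNr.
have mI : measurable (([set` Interval (BLeft (T a b y)) (BLeft b)] : set borel) `&` B) by exact: measurableI.
rewrite (_ : `]a, y] `&` _ = (fun x => - (b / (1 - a)) * x + b / (1 - a)) @^-1`
    ([set` Interval (BLeft (T a b y)) (BLeft b)] `&` B)).
  rewrite lebesgue_affine// normrN gtr0_norm// invf_div; congr (_ * _)%E.
  have mJ : measurable ((`]T a b y, b]%classic : set borel) `&` B) by exact: measurableI.
  rewrite -(lebesgue_setD1 (T a b y) mI) -[RHS](lebesgue_setD1 b mJ).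
  congr (lam _); apply/seteqP; split=> x /=; rewrite !in_itv/=.
    move=> [[/andP[Tx xb] Bx] /eqP xT]; split; last by move=> xE; rewrite xE ltxx in xb.
    by rewrite lt_neqAle eq_sym xT Tx (ltW xb).
  move=> [[/andP[Tx xb] Bx] /eqP xNb]; split; last by move=> xE; rewrite xE ltxx in Tx.
  by rewrite (ltW Tx) lt_neqAle xNb.
have Tb : T a b a = b by rewrite (T_left (lexx a)) divfK// gt_eqF.
have xb x : (b / (1 - a) * (1 - x) < b) = (a < x).
  by rewrite -[ltRHS]Tb (T_right (lexx a)) ltr_pM2l// ltrD2l ltrN2.
apply/seteqP; split=> x /=; rewrite !in_itv/= affE (T_right ay).
  move=> [/andP[ax xy]]; rewrite (T_right (ltW ax)) => Bx; split=> //.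
  by rewrite ler_pM2l// lerD2l lerN2 xy/= xb.
rewrite xb ler_pM2l// lerD2l lerN2 => -[/andP[xy ax] Bx].
by rewrite ax xy (T_right (ltW ax)).
Qed.

Let T_unit (y : RR) : 0 <= y <= 1 -> 0 <= T a b y <= b.
Proof.
move=> /andP[/RleP y0 /RleP y1].
by have [/RleP -> /RleP ->] := T_range _ _ HU _ (conj y0 y1).
Qed.

(** The preimage under T^{n+1} is pulled back through one step of T: the interval is cut at [a],
    each piece goes through its affine branch, and the measure over ]T y, b] is the value at [b]
    minus the value at T y. *)
Lemma lebesgue_sojourn n (t y : RR) : 0 <= t -> 0 <= y <= 1 ->
  lam (`]0%R, y] `&` below n t) = (sojourn a b t n y)%:E.
Proof.
move=> t0; elim: n y => [|n IH] y /andP[y0 y1].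
  rewrite (_ : _ `&` _ = `]0, Num.min y t]%classic).
    rewrite lebesgue_measure_itv/= lte_fin lt_min /= RminE -EFinB subr0.
    have [y0'|] := ltP 0 y; have [t0'|] := ltP 0 t => //=.
    - by move=> tle; congr EFin; apply/esym/le_anti; rewrite ge_min tle orbT le_min y0 t0.
    - by move=> yle; congr EFin; apply/esym/le_anti; rewrite ge_min yle le_min y0 t0.
    - by move=> _ yle; congr EFin; apply/esym/le_anti; rewrite ge_min yle le_min y0 t0.
  apply/seteqP; split=> x /=; rewrite !in_itv/= le_min.
    by move=> [/andP[x0 xy] xt]; rewrite x0 xy; exact: xt.
  by move=> /andP[x0 /andP[xy xt]]; rewrite x0 xy.
have belowS : below n.+1 t = T a b @^-1` below n t.
  by apply/seteqP; split=> x; rewrite /below /= -iterT_succ_r.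
have mB := measurable_below n t.
have Ty : 0 <= T a b y <= b by rewrite T_unit// y0.
have Ty1 : 0 <= T a b y <= 1 by case/andP: Ty => -> /le_trans -> .
have b01 : 0 <= b <= 1 by rewrite ltW.
rewrite belowS; have [ya|ay] := leP y a.
  rewrite lebesgue_T_left// IH// -EFinM; congr EFin; apply/esym.
  by apply: sojourn_left => //; exact/RleP.
have -> : `]0%R, y] `&` T a b @^-1` below n t =
    (`]0%R, a] `&` T a b @^-1` below n t) `|` (`]a, y] `&` T a b @^-1` below n t).
  rewrite -setIUl; congr (_ `&` _); apply/seteqP; split=> x /=; rewrite !in_itv/=.
    by move=> /andP[x0 xy]; have [xa|ax] := leP x a; [left; rewrite x0|right; rewrite xy].
  case=> /andP[h1 h2]; first by rewrite h1 (le_trans h2 (ltW ay)).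
  by rewrite h2 (lt_trans a0 h1).
have mTB : measurable (T a b @^-1` below n t : set borel).
  by rewrite -[X in measurable X]setTI; exact: measurable_T.
rewrite measureU//; [|exact: measurableI|exact: measurableI|]; last first.
  apply/seteqP; split=> x //=; rewrite !in_itv/= => -[[/andP[_ xa] _] [/andP[ax _] _]].
  by move: (le_lt_trans xa ax); rewrite ltxx.
rewrite [X in (X + _)%E](lebesgue_T_left mB (ltW a0) (lexx a)).
rewrite [X in (_ + X)%E](lebesgue_T_right mB (ltW ay) y1).
have -> : T a b a = b by exact: T_turning.
have split_b : lam (`]0%R, b] `&` below n t) =
    (lam (`]0%R, T a b y] `&` below n t) + lam (`]T a b y, b] `&` below n t))%E.
  case/andP: Ty => Ty0 Tyb.
  rewrite -measureU//; [|exact: measurableI|exact: measurableI|]; last first.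
    apply/seteqP; split=> x //=; rewrite !in_itv/= => -[[/andP[_ xT] _] [/andP[Tx _] _]].
    by move: (le_lt_trans xT Tx); rewrite ltxx.
  rewrite -setIUl; congr (lam (_ `&` _)); apply/seteqP; split=> x /=; rewrite !in_itv/=.
    by move=> /andP[x0 xb]; have [xT|Tx] := leP x (T a b y); [left; rewrite x0|right; rewrite xb].
  case=> /andP[h1 h2]; first by rewrite h1 (le_trans h2).
  by rewrite h2 (le_lt_trans Ty0 h1).
have -> : lam (`]T a b y, b] `&` below n t) =
    (sojourn a b t n b - sojourn a b t n (T a b y))%:E.
  rewrite EFinB -(IH b b01) split_b (IH _ Ty1) [X in (X - _)%E]addeC.
  by apply/esym/addeK.
rewrite IH// -!EFinM -EFinD; congr EFin; apply/esym.
by apply: sojourn_right => //; exact/RltP.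
Qed.

(** * The invariant measure carried by the distribution function *)

Variable F : RR -> RR.
Hypothesis HF : is_acim_cdf a b F.

Let G (x : RR) : RR := F (clamp01 x).

Let G_nd (x y : RR) : x <= y -> G x <= G y.
Proof. by move=> /RleP xy; apply/RleP; exact: ac_cdf_clamp_le (proj1 HF) xy. Qed.

Let G_cont (x e : RR) : 0 < e ->
  exists2 d, 0 < d & forall y, `|y - x| < d -> `|G y - G x| < e.
Proof.
move=> /RltP e0; have [d [d0 hd]] := ac_cdf_clamp_continuity F x e (proj1 HF) e0.
by exists d => [|y /RltP xy]; [exact/RltP|apply/RltP; rewrite -RabsE; apply: hd; rewrite RabsE].
Qed.

Let G_low (x : RR) : x <= 0 -> G x = 0.
Proof. by move=> /RleP x0; rewrite /G clamp01_low//; case: HF => -[]. Qed.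

Let G_high (x : RR) : 1 <= x -> G x = 1.
Proof. by move=> /RleP x1; rewrite /G clamp01_high//; case: HF => -[? []]. Qed.

Let G_id (x : RR) : 0 <= x <= 1 -> G x = F x.
Proof. by move=> /andP[/RleP x0 /RleP x1]; rewrite /G clamp01_id. Qed.

Let mu_ex := stieltjes_probability G_nd G_cont G_low G_high.

Let mu : probability borel RR := sval (cid mu_ex).

Let mu_oc (u v : RR) : u <= v -> mu `]u, v]%classic = (G v - G u)%:E.
Proof. exact: (proj1 (svalP (cid mu_ex))). Qed.

Let mu_unique (nu : {measure set borel -> \bar RR}) :
  (forall u v, u <= v -> nu `]u, v]%classic = (G v - G u)%:E) ->
  forall A, measurable A -> nu A = mu A.
Proof. exact: (proj2 (svalP (cid mu_ex))). Qed.

Let muD : mu D = 1%E.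
Proof. by rewrite mu_oc ?ler01// G_high// G_low// subr0. Qed.

Let muDC : mu (~` D) = 0%E.
Proof. by rewrite probability_setC ?muD ?subee//; exact: measurable_itv. Qed.

Let muI_D (A : set borel) : measurable A -> mu (D `&` A) = mu A.
Proof.
move=> mA; have mD : measurable D by exact: measurable_itv.
rewrite -[in RHS](setIT A) -(setUv D) setIUr.
rewrite measureU; [|exact: measurableI|by apply: measurableI => //; exact: measurableC|].
  rewrite [X in (_ + X)%E](_ : _ = 0%E) ?adde0 1?setIC//.
  apply/eqP; rewrite eq_le measure_ge0 andbT -[leRHS]muDC.
  apply: le_measure; rewrite ?inE//; last exact: measurableC.
  by apply: measurableI => //; exact: measurableC.
by apply/seteqP; split=> x //= [[_ xD] [_ xND]].
Qed.

Let mu_ac : mu `<< lam.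
Proof.
apply: abs_cont_null_dominates => // e /RltP e0.
have [[_ [_ [Fmono Fac]]] _] := HF.
have [d [d0 hd]] := Fac e e0; exists d; first exact/RltP.
move=> n l r lr rl lt_d.
have l01 i : (i < n)%N -> G (l i) = F (l i) /\ G (r i) = F (r i).
  by move=> /lr[l0 [lri r1]]; rewrite !G_id ?l0 ?r1 ?(le_trans l0 lri) ?(le_trans lri r1).
rewrite (eq_bigr (fun i : 'I_n => (F (r i) - F (l i))%:E)); last first.
  move=> i _; have [<- <-] := l01 i (ltn_ord i).
  by apply: mu_oc; have [_ []] := lr i (ltn_ord i).
rewrite sumEFin lee_fin.
case: n => [|n] in lr rl lt_d l01 *; first by rewrite big_ord0; exact/ltW/RltP.
have [||||] := hd n.+1 l r => //.
- by move=> i /ssrnat.ltP /lr[/RleP ? [/RleP ? /RleP ?]].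
- by move=> i /ssrnat.ltP /rl /RleP.
- by right; apply/RltP; rewrite sum_f_R0E big_mkord.
move=> /RltP /ltW; apply: le_trans; rewrite sum_f_R0E big_mkord; apply: ler_sum => i _.
by rewrite RabsE; exact: ler_norm.
Qed.

Let mu_set1 (x : RR) : mu [set x] = 0%E.
Proof.
move/null_content_dominatesP : mu_ac; apply; first exact: measurable_set1.
exact: lebesgue_measure_set1.
Qed.

Let mu_cc_le (u v : RR) : 0 <= u -> u <= v -> v <= 1 ->
  (mu `[u, v]%classic <= (F v - F u)%:E)%E.
Proof.
move=> u0 uv v1.
apply: (@le_trans _ _ (mu (`]u, v]%classic `|` [set u]))).
  apply: le_measure; rewrite ?inE; [exact: measurable_itv| |].
    by apply: measurableU; [exact: measurable_itv|exact: measurable_set1].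
  move=> x /=; rewrite !in_itv/= => /andP[]; rewrite le_eqVlt => /predU1P[->|ux xv].
    by right.
  by left; rewrite ux.
apply: le_trans (measureU2 mu (measurable_itv _) (measurable_set1 u)) _.
rewrite [X in (_ + X <= _)%E]mu_set1 adde0 [leLHS](mu_oc uv) !G_id ?u0 ?v1 ?(le_trans u0)//.
exact: le_trans uv v1.
Qed.

(** The equation for [F] speaks of 0 ≤ t ≤ 1; for other t the preimage within [D] is empty or all of
    [D]. In between, it lies between ]0,m] ∪ ]M,1] and the same set with the point [M] added, which
    has measure 0. *)
Let mu_T_below (t : RR) : mu (T a b @^-1` `]-oo, t]%classic) = (G t)%:E.
Proof.
have mPre : measurable (T a b @^-1` `]-oo, t]%classic : set borel).
  by rewrite -[X in measurable X]setTI; exact: measurable_T.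
have [t0|t0] := ltP t 0.
  rewrite (G_low (ltW t0)) -muI_D// (_ : _ `&` _ = set0) ?measure0//.
  apply/seteqP; split=> x //=; rewrite !in_itv/= => -[/andP[x0 x1] Tt].
  have /andP[T0 _] : 0 <= T a b x <= b by rewrite T_unit// ltW.
  by move: (le_lt_trans (le_trans T0 Tt) t0); rewrite ltxx.
have [t1|t1] := ltP 1 t.
  rewrite (G_high (ltW t1)) -muI_D// (_ : _ `&` _ = D) ?muD//.
  apply/seteqP; split=> x /=; [by case|move=> xD; split=> //].
  move: xD; rewrite !in_itv/= => /andP[x0 x1].
  have /andP[_ Tb] : 0 <= T a b x <= b by rewrite T_unit// ltW.
  exact: le_trans (le_trans Tb b1) (ltW t1).
have t01 : 0 <= t <= 1 by rewrite t0.
pose m : RR := Num.min a (a * t / b).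
pose M : RR := Num.max a (1 - (1 - a) * t / b).
have m0 : 0 <= m by rewrite le_min (ltW a0) divr_ge0 ?mulr_ge0 ?(ltW a0) ?(ltW b0).
have ma : m <= a by rewrite ge_min lexx.
have aM : a <= M by rewrite le_max lexx.
have M1 : M <= 1.
  by rewrite ge_max (ltW a1) lerBlDr lerDl divr_ge0 ?mulr_ge0 ?(ltW ca0) ?(ltW b0).
have inv : F (Rmin a (a * t / b)) + (1 - F (Rmax a (1 - (1 - a) * t / b))) = F t.
  by apply: (proj2 HF); split; exact/RleP.
have {}inv : F m + (1 - F M) = F t by rewrite -inv RminE RmaxE.
rewrite (G_id t01) -inv.
have scale_le (c z : RR) : 0 < c -> (b / c * z <= t) = (z <= c * t / b).
  by move=> c0; rewrite mulrAC ler_pdivrMr// ler_pdivlMr// [z * b]mulrC [t * c]mulrC.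
have sub1 : `]0%R, m]%classic `|` `]M, 1%R]%classic `<=` D `&` T a b @^-1` `]-oo, t]%classic.
  move=> x /=; rewrite !in_itv/= => -[|] /andP[].
    move=> x0; rewrite le_min => /andP[xa xat].
    rewrite x0 (le_trans xa (ltW a1)); split=> //.
    by rewrite (T_left xa) scale_le.
  rewrite gt_max => /andP[ax xM] x1.
  rewrite x1 (lt_trans a0 ax); split=> //.
  by rewrite (T_right (ltW ax)) scale_le// lerBlDr addrC -lerBlDr ltW.
have sub2 : D `&` T a b @^-1` `]-oo, t]%classic `<=`
    (`]0%R, m]%classic `|` `]M, 1%R]%classic) `|` [set M].
  move=> x /=; rewrite !in_itv/= => -[/andP[x0 x1]].
  have [xa|ax] := leP x a.
    by rewrite (T_left xa) scale_le// => Tt; left; left; rewrite x0 le_min xa.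
  rewrite (T_right (ltW ax)) scale_le// lerBlDr addrC -lerBlDr => Tt.
  have Mx : M <= x by rewrite ge_max (ltW ax).
  have [MxE|MxE] := eqVneq M x; first by right.
  by left; right; rewrite lt_neqAle MxE Mx.
have mU : mu (`]0%R, m]%classic `|` `]M, 1%R]%classic) = (F m + (1 - F M))%:E.
  rewrite measureU; [|exact: measurable_itv|exact: measurable_itv|].
    rewrite [X in (X + _)%E](mu_oc m0) [X in (_ + X)%E](mu_oc M1) -EFinD.
    rewrite (G_low (lexx 0)) (G_high (lexx 1)) subr0 !G_id//.
      by rewrite (le_trans (ltW a0) aM).
    by rewrite m0 (le_trans ma (ltW a1)).
  apply/seteqP; split=> x //=; rewrite !in_itv/= => -[/andP[_ xm] /andP[Mx _]].
  by move: (le_lt_trans (le_trans xm (le_trans ma aM)) Mx); rewrite ltxx.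
have mUm : measurable (`]0%R, m]%classic `|` `]M, 1%R]%classic : set borel).
  by apply: measurableU; exact: measurable_itv.
have mDT : measurable (D `&` T a b @^-1` `]-oo, t]%classic).
  by apply: measurableI => //; exact: measurable_itv.
rewrite -muI_D//; apply/eqP; rewrite eq_le -mU; apply/andP; split.
  apply: (@le_trans _ _ (mu ((`]0%R, m]%classic `|` `]M, 1%R]%classic) `|` [set M]))).
    apply: le_measure; rewrite ?inE//.
    by apply: measurableU => //; exact: measurable_set1.
  apply: le_trans (measureU2 mu mUm (measurable_set1 M)) _.
  by rewrite [X in (_ + X <= _)%E]mu_set1 adde0.
by apply: le_measure; rewrite ?inE.
Qed.

Lemma mu_T (A : set borel) : measurable A -> mu (T a b @^-1` A) = mu A.
Proof.
move=> mA; have [nu nuE] := pushforward_is_measure mu measurable_T.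
rewrite -nuE; apply: mu_unique => // u v uv; rewrite nuE.
have -> : `]u, v]%classic = `]-oo, v]%classic `\` `]-oo, u]%classic.
  apply/seteqP; split=> x /=; rewrite !in_itv/=.
    by move=> /andP[ux xv]; split=> //; apply/negP; rewrite -ltNge.
  by move=> [-> /negP]; rewrite -ltNge => ->.
have mPre s : measurable (T a b @^-1` `]-oo, s]%classic : set borel).
  by rewrite -[X in measurable X]setTI; apply: measurable_T => //; exact: measurable_itv.
rewrite [LHS](_ : _ = mu ((T a b @^-1` `]-oo, v]%classic) `\` (T a b @^-1` `]-oo, u]%classic)))//.
rewrite measureD//; last by rewrite (le_lt_trans (probability_le1 _ _))// ltry.
rewrite (_ : _ `&` _ = T a b @^-1` `]-oo, u]%classic).
  by rewrite [X in (X - _)%E]mu_T_below [X in (_ - X)%E]mu_T_below.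
apply/seteqP; split=> x /=; rewrite !in_itv/=; [by case|move=> Tu; split=> //].
exact: le_trans uv.
Qed.

Let mu_iterT n (A : set borel) : measurable A -> mu (iterT a b n @^-1` A) = mu A.
Proof.
elim: n A => [//|n IH] A mA.
rewrite (_ : _ @^-1` _ = iterT a b n @^-1` (T a b @^-1` A))// IH ?mu_T//.
by rewrite -[X in measurable X]setTI; exact: measurable_T.
Qed.

Let a01 : 0 <= a <= 1. Proof. by rewrite !ltW. Qed.

Let mu_below n : mu (D `&` below n a) = (F a)%:E.
Proof.
rewrite muI_D; last exact: measurable_below.
rewrite (_ : below n a = iterT a b n @^-1` `]-oo, a]%classic); last first.
  by apply/seteqP; split=> x; rewrite /= in_itv.
rewrite mu_iterT; last exact: measurable_itv.
rewrite -muI_D; last exact: measurable_itv.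
rewrite (_ : _ `&` _ = `]0, a]%classic).
  by rewrite mu_oc ?ltW// G_id// G_low// subr0.
apply/seteqP; split=> x /=; rewrite !in_itv/=; first by case=> /andP[-> _] ->.
by move=> /andP[-> xa]; rewrite xa (le_trans xa (ltW a1)).
Qed.

(** The centred frequency of visits to [0,a] has [mu]-integral F a - g at every time, by invariance.
    Its Lebesgue integral over ]0,y] is [sojourn_mean] minus y g, which tends to 0, so
    [weak_null_const] applies. *)
Lemma acim_frequency (g : RR) :
  (forall y, Rle 0 y /\ Rle y 1 ->
     is_lim_seq (fun N => sojourn_mean a b a N y) (Rmult y g)) ->
  F a = g.
Proof.
move=> hlim; apply/eqP; rewrite -subr_eq0; apply/eqP.
apply: (@weak_null_const RR mu (mean_indic (below^~ a) 1 g) (`|1| + `|g|)).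
- by move=> n; apply: measurable_mean_indic => k; exact: measurable_below.
- by move=> n x; exact: mean_indic_le.
- move=> N; rewrite Rintegral_mean_indic.
  + have -> : fine (mu D) = 1 by exact: (congr1 fine muD).
    rewrite (eq_bigr (fun _ => F a)); last by move=> n _; exact: (congr1 fine (mu_below n)).
    rewrite sumr_const card_ord mulr1 -[X in X * _ - _]mulr_natr; congr (_ - _).
    by rewrite div1r mulfK// pnatr_eq0.
  + by move=> n; exact: measurable_below.
  + exact: measurable_itv.
  + by rewrite [X in (X < _)%E]muD ltry.
- exact: mu_ac.
move=> y /andP[y0 y1] e e0.
have y01 : Rle 0 y /\ Rle y 1 by split; exact/RleP.
have [N hN] := proj1 (is_lim_seq_Reals _ _) (hlim y y01) e ltac:(exact/RltP).
have lamfin : (lam (`]0%R, y]%classic : set borel) < +oo)%E.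
  by rewrite lebesgue_measure_itv/=; case: ifP => _; rewrite -?EFinB ltry.
exists N => n Nn; rewrite Rintegral_mean_indic.
- have -> : fine (lam (`]0%R, y]%classic : set borel)) = y.
    rewrite lebesgue_measure_itv/= lte_fin; case: ltP => [_|y0']; first by rewrite -EFinB subr0.
    by apply/le_anti; rewrite y0.
  rewrite (eq_bigr (fun k : 'I_n.+1 => sojourn a b a k y)); last first.
    by move=> k _; apply: (congr1 fine (lebesgue_sojourn k (ltW a0) _)); rewrite y0.
  have := hN n (elimT ssrnat.leP Nn); rewrite RdistE => /RltP /ltW.
  by rewrite /sojourn_mean sum_f_R0E big_mkord INRE RdivE div1r RmultE [g * y]mulrC.
- by move=> k; exact: measurable_below.
- exact: measurable_itv.
- exact: lamfin.
Qed.

(** One cover of total mass below 1 / (k + 1) is chosen for each k. The intersection of these covers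
    is a measurable null set containing B within [D]. *)
Let mu_null_negligible (B : RR -> Prop) : mu_null F B -> mu.-negligible (D `&` B).
Proof.
move=> nullB.
have cov k : exists lr : (nat -> RR) * (nat -> RR),
    [/\ forall n, 0 <= lr.1 n /\ lr.1 n <= lr.2 n /\ lr.2 n <= 1,
        forall x, D x -> B x -> exists n, lr.1 n <= x <= lr.2 n &
        forall N, \sum_(0 <= n < N.+1) (F (lr.2 n) - F (lr.1 n)) < k.+1%:R^-1].
  have k0 : Rlt 0 (k.+1%:R^-1 : RR) by apply/RltP; rewrite invr_gt0 ltr0n.
  have [l [r [hlr [hcov hsum]]]] := nullB _ k0; exists (l, r); split => /=.
  - by move=> n; have [[/RleP ? /RleP ?] /RleP ?] := hlr n.
  - move=> x; rewrite /= in_itv/= => /andP[/ltW /RleP x0 /RleP x1] Bx.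
    by have [n [/RleP ? /RleP ?]] := hcov x (conj x0 x1) Bx; exists n; apply/andP.
  - by move=> N; have := hsum N; rewrite sum_f_R0E => /RltP.
pose lr k := sval (cid (cov k)).
have lrP k := svalP (cid (cov k)); rewrite -/(lr _) in lrP.
pose C k : set borel := \bigcup_n `[(lr k).1 n, (lr k).2 n]%classic.
have mC k : measurable (C k) by apply: bigcupT_measurable => n; exact: measurable_itv.
exists (\bigcap_k C k); split.
- exact: bigcapT_measurable.
- apply/eqP; rewrite eq_le measure_ge0 andbT; apply/lee_addgt0Pr => e e0; rewrite add0e.
  have [k _ hk] : \forall k \near \oo, k.+1%:R^-1 < e by exact: (near_infty_natSinv_lt (PosNum e0)).
  apply: (@le_trans _ _ (mu (C k))).
    by apply: le_measure; rewrite ?inE//; [exact: bigcapT_measurable|exact: bigcap_inf].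
  have {}hk := ltW (hk k (leqnn k)).
  have [lr01 _ lrsum] := lrP k.
  apply: (@le_trans _ _ (k.+1%:R^-1)%:E); last by rewrite lee_fin.
  have mcc n : measurable (`[(lr k).1 n, (lr k).2 n]%classic : set borel) by exact: measurable_itv.
  apply: le_trans (generalized_Boole_inequality mu mcc (mC k)) _.
  apply: lime_le; first by apply: is_cvg_nneseries => *; exact: measure_ge0.
  apply: nearW => -[|N]; first by rewrite big_nil lee_fin invr_ge0 ler0n.
  apply: (@le_trans _ _ (\sum_(0 <= n < N.+1) (F ((lr k).2 n) - F ((lr k).1 n)))%:E).
    rewrite -sumEFin; apply: lee_sum => n _; have [l0 [lrn r1]] := lr01 n.
    exact: mu_cc_le.
  by rewrite lee_fin ltW.
- move=> x [Dx Bx] k _; have [_ covk _] := lrP k.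
  by have [n xn] := covk x Dx Bx; exists n => //=; rewrite in_itv.
Qed.

(** At a good point the mean logarithm of the derivative is q + (p - q) times the visit frequency
    and tends to [Lam], so [psi] tends to 0 there. Its integral is constantly (p - q) F a - (Lam -
    q), which must therefore vanish. *)
Lemma acim_lyapunov (Lam : RR) : is_lyapunov a b F Lam ->
  Lam = (F a * Rpower.ln (b / a) + (1 - F a) * Rpower.ln (b / (1 - a)))%coqR.
Proof.
move=> lyap; set p := Rpower.ln (b / a)%coqR; set q := Rpower.ln (b / (1 - a))%coqR.
pose psi := mean_indic (below^~ a) (p - q) (Lam - q).
suff c0 : (p - q) * F a - (Lam - q) = 0.
  move/eqP : c0; rewrite subr_eq0 => /eqP c0.
  rewrite RplusE !RmultE mulrBl mul1r addrCA -[F a * q]mulrC -[F a * p]mulrC.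
  by rewrite -mulrBl c0 addrC subrK.
(* Off the null set of orbits through [a], the derivatives are products of slopes. *)
pose hits := \bigcup_n (iterT a b n @^-1` [set a] : set borel).
have mhit n : measurable (iterT a b n @^-1` [set a] : set borel).
  by rewrite -[X in measurable X]setTI; apply: measurable_iterT => //; exact: measurable_set1.
have hits0 : mu.-negligible hits.
  apply: negligible_bigcup => n; exists (iterT a b n @^-1` [set a]); split=> //.
  by apply: etrans (mu_set1 a); apply: mu_iterT; exact: measurable_set1.
apply: (@ae_null_const RR mu psi (`|p - q| + `|Lam - q|) _ _ _ _ _
  (negligibleU (mu_null_negligible lyap) hits0)).
- by move=> n; apply: measurable_mean_indic => k; exact: measurable_below.
- by move=> n x; exact: mean_indic_le.
- move=> N; rewrite Rintegral_mean_indic.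
  + have -> : fine (mu D) = 1 by exact: (congr1 fine muD).
    rewrite (eq_bigr (fun _ => F a)); last by move=> n _; exact: (congr1 fine (mu_below n)).
    rewrite sumr_const card_ord mulr1 -[X in X * _ - _]mulr_natr; congr (_ - _).
    by rewrite mulrA mulrAC mulfK ?pnatr_eq0// mulrC.
  + by move=> n; exact: measurable_below.
  + exact: measurable_itv.
  + by rewrite [X in (X < _)%E]muD ltry.
move=> x Dx nbad e e0.
have [d [dder dlim]] : exists d : nat -> RR,
    (forall N, derivable_pt_lim (iterT a b N) x (d N)) /\
    Un_cv (fun N => Rdiv (Rpower.ln (Rabs (d (S N)))) (INR (S N))) Lam.
  by apply: contrapT => nd; apply: nbad; left; split.
have nhit n : iterT a b n x <> a by move=> hit; apply: nbad; right; exists n.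
have [N hN] := dlim e ltac:(exact/RltP); exists N => n Nn.
have := hN n (elimT ssrnat.leP Nn); rewrite RdistE => /RltP /ltW.
rewrite (iterT_derivative_log a b x d HU nhit dder) sum_f_R0E big_mkord INRE RdivE.
congr (`| _ | <= _); rewrite -/p -/q /psi /mean_indic.
have -> : \sum_(i < n.+1) (match Rle_dec (iterT a b i x) a with left _ => p | right _ => q end) =
    (p - q) * (\sum_(i < n.+1) \1_(below i a) x) + q * n.+1%:R.
  elim: n.+1 => [|m IH]; first by rewrite !big_ord0 !mulr0 addr0.
  rewrite !big_ord_recr/= IH -natr1 !mulrDr mulr1 addrACA; congr (_ + _).
  rewrite indicE; case: Rle_dec => [/RleP xa|/RleP xa].
    by rewrite mem_set// mulr1 subrK.
  by rewrite memNset ?mulr0 ?add0r//; exact/negP.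
rewrite mulrDl mulfK ?pnatr_eq0// opprB addrA; congr (_ - _).
by congr (_ + _); rewrite mulrA [_ * (p - q)]mulrC.
Qed.

End TentMeasure.

From Stdlib Require Import Reals.
Open Scope R_scope.
Unset Implicit Arguments.

Theorem theorem1p2 (a0 b0 : R) (HU : inU a0 b0)
  (a1 a2 : R) (Psi : R -> R)
  (Ha12 : a1 < a2)
  (HPsiU : forall a, a1 < a < a2 -> inU a (Psi a))
  (HPsicont : forall a, a1 < a < a2 -> continuity_pt Psi a)
  (Hisentrope : forall a b, inU a b ->
      (knead_eq a b a0 b0 <-> (a1 < a < a2 /\ b = Psi a)))
  (F : R -> R) (HF : is_acim_cdf a0 b0 F)
  (Lam : R) (HLam : is_lyapunov a0 b0 F Lam) :
  exists dPsi : R,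
    derivable_pt_lim Psi a0 dPsi /\
    (let gamma := (dPsi / b0 + 1 / (1 - a0)) / (1 / a0 + 1 / (1 - a0)) in
     gamma = a0 * (1 - a0) * (dPsi / b0) + a0 /\
     Lam = gamma * ln (b0 / a0) + (1 - gamma) * ln (b0 / (1 - a0)) /\
     gamma = F a0).
Proof.
  destruct (inU_bounds a0 b0 HU) as (ha & ha1 & hb & _).
  destruct (proj1 (Hisentrope a0 b0 HU) ltac:(intros n; reflexivity)) as [h0 hP0].
  set (d0 := Rmin (a0 - a1) (a2 - a0)).
  assert (hd0 : 0 < d0) by (apply Rmin_glb_lt; lra).
  assert (hnear : forall x, Rabs (x - a0) < d0 -> inU x (Psi x) /\ same_sides a0 b0 x (Psi x)).
  { intros x hx; apply Rabs_def2 in hx.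
    pose proof (Rmin_l (a0 - a1) (a2 - a0)); pose proof (Rmin_r (a0 - a1) (a2 - a0)).
    assert (hx12 : a1 < x < a2) by (unfold d0 in hx; lra).
    split; [now apply HPsiU|].
    apply knead_eq_same_sides; [exact HU | now apply HPsiU|].
    now apply Hisentrope; [apply HPsiU|]. }
  exists (wshift a0 b0 / wtotal a0 b0); split.
  { apply (isentrope_derivative a0 b0 HU Psi d0 hd0 hnear); [now symmetry | now apply HPsicont]. }
  cbv zeta.
  (* [gamma] is put in the form a0 (1 - a0) Ψ' / b0 + a0, which [frequency_formula] evaluates. *)
  match goal with |- ?g = ?e /\ _ => assert (hg : g = e); [|rewrite hg] end.
  { field; repeat split; try lra; apply wtotal_neq0, HU. }
  assert (hF : F a0 = a0 * (1 - a0) * (wshift a0 b0 / wtotal a0 b0 / b0) + a0).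
  { rewrite (frequency_formula a0 b0 HU).
    apply (acim_frequency HU HF); intros y hy.
    apply (sojourn_mean_lim a0 b0 HU a0 y); [lra | exact hy]. }
  split; [reflexivity | split; [|now symmetry]].
  rewrite <- hF; apply (acim_lyapunov HU HF HLam).
Qed.
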